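(* Let $n\ge1$ and let $f\in\mathbf{k}[x_1,\dots,x_n]$ be homogeneous of degree $n-1$. Suppose $f=g+h$ with $g\in L_n$ and $h\in\mathrm{QSym}_n^+$. Then $$\langle f\rangle_n^q=g(1,q,q^2,\dots,q^{n-1}).$$ In particular, for $c\in\mathrm{ABB}_n$ with $|c|=n-1$, $\langle x_1^{c_1}\cdots x_n^{c_n}\rangle_n^q=q^{\sum_{i=1}^n(i-1)c_i}$.
   Context: Let $\mathbf{k}$ be a field of characteristic zero and $q\in\mathbf{k}$ not a nontrivial root of unity. $\mathrm{QSym}_n^+$ is the ideal of $\mathbf{k}[x_1,\dots,x_n]$ generated by quasisymmetric polynomials in $x_1,\dots,x_n$ without constant term. $\mathrm{ABB}_n=\{(c_1,\dots,c_n)\in\mathbb{N}^n:\sum_{j=i}^nc_j\le n-i\text{ for all }1\le i\le n\}$, and $L_n$ is the $\mathbf{k}$-span of the monomials $x_1^{c_1}\cdots x_n^{c_n}$ with $c\in\mathrm{ABB}_n$. For $1\le j\le n-1$, $s_j$ swaps $x_j,x_{j+1}$, $\partial_j g=(g-s_jg)/(x_j-x_{j+1})$, $T_j(g)=(q-1)\partial_j(x_jg)+s_jg$; $T_w=T_{j_1}\cdots T_{j_\ell}$ for a reduced word of $w\in S_n$; $\langle f\rangle_n^q=\sum_{w\in S_n}T_w\big(f/\prod_{j=1}^{n-1}(qx_j-x_{j+1})\big)$. *)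

(* Defs.v *)
From HB Require Import structures.
From mathcomp Require Import all_boot all_order all_algebra all_fingroup.
From mathcomp Require Import mpoly.
Set Implicit Arguments. Unset Strict Implicit. Unset Printing Implicit Defensive.
Import Order.TTheory GRing.Theory Num.Theory.
Local Open Scope ring_scope.

(* Variables x_1..x_n are 'X_0 .. 'X_(n-1) (0-indexed).  The simple
   transposition s_j (1 <= j <= n-1, paper indexing) swaps x_j and x_{j+1},
   i.e. the 0-indexed variables j-1 and j. *)

Notation "x %:F" := (@FracField.tofrac _ x) (format "x %:F").

Section QSymDefs.
Variables (n : nat) (k : fieldType).

Definition Poly := {mpoly k[n]}.
Definition RF := {fraction {mpoly k[n]}}.

Definition xv (i : nat) : RF :=
  match @insub _ (fun x => x < n)%N 'I_n i with
  | Some o => ('X_o : {mpoly k[n]})%:F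
  | None => 0 end.

Definition sperm (j : nat) : 'S_n :=
  match @insub _ (fun x => x < n)%N 'I_n j.-1,
        @insub _ (fun x => x < n)%N 'I_n j with
  | Some a, Some b => tperm a b
  | _, _ => 1%g end.

Definition valid_word (u : seq nat) : bool := all (fun j => (0 < j < n)%N) u.
Definition word_prod (u : seq nat) : 'S_n :=
  foldr (fun j w => (sperm j * w)%g) 1%g u.
Definition reduced_word (u : seq nat) (w : 'S_n) : Prop :=
  [/\ valid_word u, word_prod u = w &
      forall u', valid_word u' -> word_prod u' = w -> (size u <= size u')%N].

Definition sfrac (j : nat) (g : RF) : RF :=
  let r := generic_quotient.repr g in
  (msym (sperm j) (frac r).1)%:F / (msym (sperm j) (frac r).2)%:F.

Definition ddiff (j : nat) (g : RF) : RF :=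
  (g - sfrac j g) / (xv j.-1 - xv j).

Definition Top (q : k) (j : nat) (g : RF) : RF :=
  ((q - 1)%:MP : {mpoly k[n]})%:F * ddiff j (xv j.-1 * g) + sfrac j g.

Definition Tword (q : k) (u : seq nat) (g : RF) : RF :=
  foldr (fun j acc => Top q j acc) g u.

(* <f>_n^q, where rw w is (a chosen) reduced word for w *)
Definition bracket (q : k) (rw : 'S_n -> seq nat) (f : {mpoly k[n]}) : RF :=
  \sum_(w : 'S_n) Tword q (rw w)
     (f%:F / \prod_(0 <= i < n.-1) ((q%:MP : {mpoly k[n]})%:F * xv i - xv i.+1)).

Definition flat (m : 'X_{1..n}) : seq nat :=
  [seq e <- [seq m i | i <- enum 'I_n] | e != 0%N].
Definition quasisym (p : {mpoly k[n]}) : Prop :=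
  forall m m' : 'X_{1..n}, flat m = flat m' -> p@_m = p@_m'.

Definition in_QSymPlus (h : {mpoly k[n]}) : Prop :=
  exists s : seq ({mpoly k[n]} * {mpoly k[n]}),
    (forall x, x \in s -> quasisym x.2 /\ x.2@_0%MM = 0) /\
    h = \sum_(x <- s) x.1 * x.2.

Definition ABB (c : 'X_{1..n}) : bool :=
  [forall i : 'I_n, (\sum_(j : 'I_n | (i <= j)%N) c j <= n.-1 - i)%N].

Definition in_L (g : {mpoly k[n]}) : Prop := forall m, m \in msupp g -> ABB m.

Definition homog_of_deg (d : nat) (p : {mpoly k[n]}) : Prop :=
  forall m, m \in msupp p -> mdeg m = d.

End QSymDefs.

(* Main.v *)
Require Import Defs.
From HB Require Import structures.
From mathcomp Require Import all_boot all_order all_algebra all_fingroup.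
From mathcomp Require Import mpoly.
From mathcomp Require Import ring zify.
Import Order.TTheory GRing.Theory Num.Theory.
Local Open Scope ring_scope.
Set Implicit Arguments. Unset Strict Implicit. Unset Printing Implicit Defensive.

(** Let [Delta = \prod_(i < j) (x_i - x_j)].  The symmetrizer [\sum_w T_w] equals
    [f |-> \sum_w w (f * \prod_(i < j) (q x_i - x_j) / Delta)], so that
    [<f> = \sum_w w (f * \prod_(i + 1 < j) (q x_i - x_j) / Delta)].  The numerator
    [f * \prod_(i + 1 < j) (q x_i - x_j)] has the degree of [Delta], hence [<f>] is a constant,
    and it may be computed at any point with distinct coordinates.  At a point
    with last coordinate [0], the sum splits according to the position of that
    [0] and yields [<p>_(n+1) = \sum_s q^s <t_s p>_n], where the trimming
    operator [t_s p (z) = (p(.., z_s, 0, ..) - p(.., 0, z_s, ..)) / z_s] compares the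
    two insertions of [0] next to [z_s].  A quasisymmetric polynomial [Q] is insensitive to the
    position of the [0], so [t_s (f Q) = t_s(f) * Q(.., 0)] and [<f Q>] vanishes by
    induction on [n]; on ABB monomials the recursion telescopes to evaluation at
    [(1, q, .., q^(n-1))]. *)

(** * Length and descents of permutations *)

Section Length.
Variable m : nat.
Local Notation n := m.+1.

Definition sadj (j : nat) : 'S_n := tperm (inord j.-1) (inord j).

Definition desc (j : nat) (w : 'S_n) : bool :=
  (w (inord j) < w (inord j.-1))%N.

(* Inversions are recorded as pairs of values [c < d], not of positions. *)
Definition invset (w : 'S_n) : {set 'I_n * 'I_n} :=
  [set p : 'I_n * 'I_n | (p.1 < p.2)%N && ((w^-1)%g p.2 < (w^-1)%g p.1)%N].

Definition plen (w : 'S_n) : nat := #|invset w|.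

Lemma inord_predE j : (0 < j < n)%N ->
  (inord j.-1 : 'I_n) = j.-1 :> nat /\ (inord j : 'I_n) = j :> nat.
Proof. by move=> /andP[j0 jn]; split; rewrite inordK //; lia. Qed.

Lemma inord_neq i j : (i < n)%N -> (j < n)%N -> i != j -> (inord i : 'I_n) != inord j.
Proof. by move=> *; rewrite -val_eqE /= !inordK. Qed.

Lemma inord_pred_neq j : (0 < j < n)%N -> (inord j.-1 : 'I_n) != inord j.
Proof. by move=> hj; rewrite -val_eqE /=; have [-> ->] := inord_predE hj; lia. Qed.

Lemma sadjK j : involutive (mulg (sadj j)).
Proof. by move=> w; rewrite /sadj tpermKg. Qed.

Lemma sadjL j w : (sadj j * w)%g (inord j.-1) = w (inord j).
Proof. by rewrite permM tpermL. Qed.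

Lemma sadjR j w : (sadj j * w)%g (inord j) = w (inord j.-1).
Proof. by rewrite permM tpermR. Qed.

Lemma desc_sadj j w : (0 < j < n)%N -> desc j (sadj j * w)%g = ~~ desc j w.
Proof.
move=> hj; rewrite /desc sadjL sadjR -leqNgt ltn_neqAle.
by rewrite val_eqE (inj_eq perm_inj) inord_pred_neq.
Qed.

(** Left multiplication by [sadj j] exchanges what sits at the positions [j - 1] and [j]. As
    inversions are pairs of values, only the pair of values at these positions changes status. *)
Lemma invset_desc j w : (0 < j < n)%N -> desc j w ->
  invset w = (w (inord j), w (inord j.-1)) |: invset (sadj j * w)%g /\
  (w (inord j), w (inord j.-1)) \notin invset (sadj j * w)%g.
Proof.
move=> hj hd; have [ea eb] := inord_predE hj; move: hd; rewrite /desc /sadj.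
set a : 'I_n := inord j.-1; set b : 'I_n := inord j => hd.
have eab : b = a.+1 :> nat by rewrite ea eb; lia.
split; last first.
  rewrite !inE /= invMg !permM tpermV !permK tpermL tpermR hd /=; lia.
apply/setP => -[c d]; rewrite !inE /= invMg !permM tpermV xpair_eqE.
have -> : c = w ((w^-1)%g c) by rewrite permKV.
have -> : d = w ((w^-1)%g d) by rewrite permKV.
rewrite !permK !(inj_eq perm_inj).
move: ((w^-1)%g c) ((w^-1)%g d) => {}c {}d.
have key (i k : 'I_n) : (i == k) = (i == k :> nat) by rewrite -val_eqE.
case: (tpermP a b d) => [->|->|/eqP + /eqP]; rewrite ?key;
case: (tpermP a b c) => [->|->|/eqP + /eqP]; rewrite ?key => *; lia.
Qed.

Lemma plen_desc j w : (0 < j < n)%N -> desc j w ->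
  plen w = (plen (sadj j * w)%g).+1.
Proof. by move=> hj hd; have [e h] := invset_desc hj hd; rewrite /plen e cardsU1 h. Qed.

Lemma plen_asc j w : (0 < j < n)%N -> ~~ desc j w ->
  plen (sadj j * w)%g = (plen w).+1.
Proof.
by move=> hj hd; rewrite (@plen_desc j) // ?desc_sadj // sadjK.
Qed.

Lemma plen_sadj_ge j w : (0 < j < n)%N -> (plen w <= (plen (sadj j * w)%g).+1)%N.
Proof.
move=> hj; case/boolP: (desc j w) => hd; first by rewrite (plen_desc hj).
by rewrite plen_asc //; lia.
Qed.

Lemma plen1 : plen 1%g = 0%N.
Proof.
apply/eqP; rewrite /plen cards_eq0; apply/eqP/setP => p.
by rewrite !inE invg1 !perm1; lia.
Qed.

(** Without descents [w] is increasing, so [w i >= i] for all [i]; both sides have the same sum,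
    hence equality holds everywhere. *)
Lemma no_desc_eq1 w : (forall j, (0 < j < n)%N -> ~~ desc j w) -> w = 1%g.
Proof.
move=> h.
have ge k : (k < n)%N -> (k <= w (inord k))%N.
  elim: k => // k IH hk; have := h k.+1; rewrite /desc /= hk => /(_ isT).
  have := IH (ltnW hk).
  have : w (inord k.+1) != w (inord k) :> nat.
    by rewrite val_eqE (inj_eq perm_inj) -val_eqE /= !inordK //; lia.
  lia.
have ge' (i : 'I_n) : true -> (i <= w i ?= iff (i == w i :> nat))%N.
  by move=> _; split=> //; have := ge i (ltn_ord i); rewrite inord_val.
have [_] := leqif_sum ge'.
rewrite -(reindex_inj (F := fun i : 'I_n => (i : nat)) (P := xpredT) (@perm_inj _ w)).
rewrite eqxx => /esym/forallP e; apply/permP => i.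
by rewrite perm1; apply: val_inj; apply/esym/eqP; exact: (e i).
Qed.

(* [desc_word u w]: [u] spells [w] and each letter is a descent of what remains to be spelled. *)
Fixpoint desc_word (u : seq nat) (w : 'S_n) : bool :=
  if u is j :: u' then [&& (0 < j < n)%N, desc j w & desc_word u' (sadj j * w)%g]
  else w == 1%g.

Lemma desc_word_size u w : desc_word u w -> size u = plen w.
Proof.
elim: u w => [|j u IH] w /=; first by move/eqP->; rewrite plen1.
by case/and3P => hj hd /IH ->; rewrite (plen_desc hj hd).
Qed.

Lemma exists_desc_word w : exists u, desc_word u w.
Proof.
have [l] := ubnP (plen w); elim: l w => // l IH w hl.
case/boolP: [exists j : 'I_n, (0 < j)%N && desc j w] => [/existsP[j /andP[j0 hd]]|hn].
  have hj : (0 < j < n)%N by rewrite j0 ltn_ord.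
  have [|u hu] := IH (sadj j * w)%g; first by rewrite (plen_desc hj hd) in hl; lia.
  by exists (val j :: u) => /=; rewrite hj hd hu.
exists [::]; apply/eqP; apply: no_desc_eq1 => j /andP[j0 jn].
apply: contra hn => hd; apply/existsP; exists (Ordinal jn) => /=.
by rewrite j0 hd.
Qed.

Lemma sperm_sadj j : (0 < j < n)%N -> sperm n j = sadj j.
Proof.
move=> /andP[j0 jn]; rewrite /sperm /sadj.
have jn' : (j.-1 < n)%N by lia.
by rewrite !insubT /=; congr tperm; apply: val_inj; rewrite /= inordK.
Qed.

Lemma desc_word_prod u w : desc_word u w -> valid_word n u /\ word_prod n u = w.
Proof.
elim: u w => [|j u IH] w /=; first by move/eqP->.
case/and3P => hj hd /IH[vu pu]; rewrite hj; split=> //.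
by rewrite sperm_sadj // pu sadjK.
Qed.

Lemma size_word_prod_ge u : valid_word n u -> (plen (word_prod n u) <= size u)%N.
Proof.
elim: u => [|j u IH] /=; first by rewrite plen1.
case/andP => hj /IH; rewrite sperm_sadj //.
by have := plen_sadj_ge (sadj j * word_prod n u)%g hj; rewrite sadjK; lia.
Qed.

(** Decreasing words exist, so a minimal word has exactly [plen w] letters. A letter that is not a
    descent would leave a tail spelling a permutation with more inversions than the tail has
    letters. *)
Lemma reduced_desc_word u w : reduced_word u w -> desc_word u w.
Proof.
case=> vu <- hmin.
have {hmin} : size u = plen (word_prod n u).
  apply/eqP; rewrite eqn_leq size_word_prod_ge // andbT.
  have [v hv] := exists_desc_word (word_prod n u).
  have [? ?] := desc_word_prod hv.
  by rewrite -(desc_word_size hv) hmin.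
elim: u vu => [|j u IH] //= /andP[hj vu]; rewrite sperm_sadj // sadjK hj /=.
have := size_word_prod_ge vu => hle.
case/boolP: (desc j (sadj j * word_prod n u)%g) => hd hs /=.
  by apply: IH => //; rewrite (plen_desc hj hd) sadjK in hs; lia.
by have := plen_asc hj hd; rewrite sadjK; lia.
Qed.

End Length.

(** * The Hecke symmetrizer *)

Section Hecke.
Variables (m : nat) (K : fieldType) (q : K).
Local Notation n := m.+1.
Variable x : 'I_n -> K.
Hypothesis x_inj : injective x.
Hypothesis x_qneq : forall i j, i != j -> x i - q * x j != 0.

Local Notation V := {ffun 'S_n -> K}.
Local Notation s := (@sadj m).
Local Notation xp j w := (x (w (inord j : 'I_n))).

(* The action of T_j on a rational function [g], read on the orbit function [w |-> w g]:
   [x i] stands for the variable x_(i+1). *)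
Definition hecke_op (j : nat) (G : V) : V :=
  [ffun w : 'S_n => (q - 1) * ((xp j.-1 w * G w - xp j w * G (s j * w)%g)
                         / (xp j.-1 w - xp j w)) + G (s j * w)%g].

Definition hecke_word (u : seq nat) (G : V) : V := foldr hecke_op G u.

Lemma subr_neq0C (a b : K) : a - b != 0 -> b - a != 0.
Proof. by rewrite -opprB oppr_eq0. Qed.

Lemma xp_sub_neq0 i j (w : 'S_n) : (i < n)%N -> (j < n)%N -> i != j -> xp i w - xp j w != 0.
Proof.
move=> hi hj hij; rewrite subr_eq0 (inj_eq x_inj) (inj_eq perm_inj).
by rewrite -val_eqE /= !inordK.
Qed.

Lemma hecke_op_sum j (I : Type) (r : seq I) (P : pred I) (F : I -> V) :
  hecke_op j (\sum_(i <- r | P i) F i) = \sum_(i <- r | P i) hecke_op j (F i).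
Proof.
have h0 : hecke_op j 0 = 0.
  by apply/ffunP => w; rewrite !ffunE !mulr0 subrr mul0r mulr0 addr0.
have hD (a b : V) : hecke_op j (a + b) = hecke_op j a + hecke_op j b.
  by apply/ffunP => w; rewrite !ffunE; ring.
exact: (big_morph (hecke_op j) hD h0).
Qed.

Lemma hecke_op_scale j c (G : V) : hecke_op j [ffun w => c * G w] = [ffun w => c * hecke_op j G w].
Proof. by apply/ffunP => w; rewrite !ffunE; ring. Qed.

Lemma hecke_opE j (G : V) w : (0 < j < n)%N ->
  hecke_op j G w = (q - 1) * xp j.-1 w / (xp j.-1 w - xp j w) * G w
    + (xp j.-1 w - q * xp j w) / (xp j.-1 w - xp j w) * G (s j * w)%g.
Proof.
move=> hj; rewrite ffunE.
have : xp j.-1 w - xp j w != 0 by apply: xp_sub_neq0; lia.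
by move: (xp _ _) (xp _ _) => a b ?; field.
Qed.

Lemma hecke_op_quad j (G : V) : (0 < j < n)%N ->
  hecke_op j (hecke_op j G) = [ffun w => (q - 1) * hecke_op j G w + q * G w].
Proof.
move=> hj; apply/ffunP => w; rewrite !ffunE sadjL sadjR sadjK.
have : xp j.-1 w - xp j w != 0 by apply: xp_sub_neq0; lia.
move: (xp _ _) (xp _ _) => a b h.
by field; rewrite h subr_neq0C.
Qed.

Lemma sadj_comm i j w : (0 < i)%N -> (i.+1 < j < n)%N ->
  (s i * (s j * w) = s j * (s i * w))%g.
Proof.
move=> hi hj.
rewrite !mulgA; congr (_ * _)%g; rewrite conjgC tpermJ !tpermD ?inord_neq //; lia.
Qed.

Lemma sadjD i k w : (0 < i < n)%N -> (k < n)%N -> k != i.-1 -> k != i ->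
  (s i * w)%g (inord k) = w (inord k).
Proof.
move=> hi hk h1 h2; rewrite permM tpermD // -val_eqE /= !inordK //; lia.
Qed.

Lemma hecke_op_comm i j (G : V) : (0 < i)%N -> (i.+1 < j < n)%N ->
  hecke_op i (hecke_op j G) = hecke_op j (hecke_op i G).
Proof.
move=> hi hj; apply/ffunP => w; rewrite !ffunE (@sadj_comm i j) // !sadjD; try lia.
have : xp i.-1 w - xp i w != 0 by apply: xp_sub_neq0; lia.
have : xp j.-1 w - xp j w != 0 by apply: xp_sub_neq0; lia.
move: (xp _ _) (xp _ _) (xp _ _) (xp _ _) => a b c d h1 h2.
by field; rewrite h1 h2.
Qed.

Lemma sadj_braid i : (0 < i)%N -> (i.+1 < n)%N ->
  (s i * (s i.+1 * s i) = s i.+1 * (s i * s i.+1))%g.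
Proof.
move=> hi hi1; rewrite /sadj /=.
have e1 (a b c : 'I_n) : a != b -> a != c -> b != c ->
   (tperm a b * (tperm b c * tperm a b) = tperm a c)%g.
  move=> ab ac bc; have := tpermJ b c (tperm a b).
  rewrite /conjg tpermV tpermR tpermD // => -> //.
rewrite e1 ?inord_neq; try lia.
rewrite [tperm (inord i) (inord i.+1)]tpermC [tperm (inord i.-1) (inord i)]tpermC.
rewrite e1 ?inord_neq; try lia.
exact: tpermC.
Qed.

Lemma hecke_op_braid i (G : V) : (0 < i)%N -> (i.+1 < n)%N ->
  hecke_op i (hecke_op i.+1 (hecke_op i G)) = hecke_op i.+1 (hecke_op i (hecke_op i.+1 G)).
Proof.
move=> hi hi1; apply/ffunP => w.
have L1 v : (s i * v)%g (inord i.-1) = v (inord i) by exact: sadjL.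
have R1 v : (s i * v)%g (inord i) = v (inord i.-1) by exact: sadjR.
have L2 v : (s i.+1 * v)%g (inord i) = v (inord i.+1) by exact: sadjL.
have R2 v : (s i.+1 * v)%g (inord i.+1) = v (inord i) by exact: sadjR.
have D1 v : (s i * v)%g (inord i.+1) = v (inord i.+1).
  by apply: sadjD; lia.
have D2 v : (s i.+1 * v)%g (inord i.-1) = v (inord i.-1).
  by apply: sadjD; lia.
have br v : (s i * (s i.+1 * (s i * v)) = s i.+1 * (s i * (s i.+1 * v)))%g.
  by have := sadj_braid hi hi1; rewrite !mulgA => ->.
rewrite !ffunE /= !(L1, R1, L2, R2, D1, D2) !sadjK br.
have : xp i.-1 w - xp i w != 0 by apply: xp_sub_neq0; lia.
have : xp i.-1 w - xp i.+1 w != 0 by apply: xp_sub_neq0; lia.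
have : xp i w - xp i.+1 w != 0 by apply: xp_sub_neq0; lia.
move: (xp _ _) (xp _ _) (xp _ _) => c b a h1 h2 h3.
move: (G _) (G _) (G _) (G _) (G _) (G _) => g1 g2 g3 g4 g5 g6.
by field; rewrite ?h1 ?h2 ?h3 ?(subr_neq0C h1) ?(subr_neq0C h2) ?(subr_neq0C h3).
Qed.

(* Matsumoto's theorem: if [i] and [j] are both descents of [w], then [w] has decreasing words
   starting with either side of the braid or commutation relation between [i] and [j]. *)
Lemma matsumoto u v (w : 'S_n) (G : V) : desc_word u w -> desc_word v w -> hecke_word u G = hecke_word v G.
Proof.
have [l] := ubnP (plen w); elim: l u v w => // l IH u v w hl hu hv.
case: u v hu hv => [|i u] [|j v] //.
- by move=> /desc_word_size h /desc_word_size; rewrite -h.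
- by move=> /desc_word_size h /desc_word_size; rewrite -h.
rewrite /= => /and3P[hi di hu] /and3P[hj dj hv].
wlog lij : i j u v hi hj di dj hu hv / (i <= j)%N => [hw|].
  case: (leqP i j) => h; first exact: hw.
  by apply/esym/hw => //; exact: ltnW.
have li := plen_desc hi di; have lj := plen_desc hj dj.
have IHi u' v' : desc_word u' (s i * w)%g -> desc_word v' (s i * w)%g -> hecke_word u' G = hecke_word v' G.
  by apply: IH; lia.
have IHj u' v' : desc_word u' (s j * w)%g -> desc_word v' (s j * w)%g -> hecke_word u' G = hecke_word v' G.
  by apply: IH; lia.
case: (ltngtP i j) lij => // [hij _|eij _]; last first.
  by subst j; rewrite (IHi _ _ hu hv).
case: (ltngtP i.+1 j) (hij) => // [hij2 _|eij _].
- have c12 v' : (s i * (s j * v') = s j * (s i * v'))%g.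
    by apply: sadj_comm; lia.
  have [z hz] := exists_desc_word (s i * (s j * w))%g.
  have Di : desc_word (j :: z) (s i * w)%g.
    by rewrite /= hj -c12 hz /desc !sadjD ?andbT; try lia; exact: dj.
  have Dj : desc_word (i :: z) (s j * w)%g.
    by rewrite /= hi hz /desc !sadjD ?andbT; try lia; exact: di.
  rewrite (IHi _ _ hu Di) (IHj _ _ hv Dj) /= hecke_op_comm //; lia.
- subst j.
  have L1 v' : (s i * v')%g (inord i.-1) = v' (inord i) by exact: sadjL.
  have R1 v' : (s i * v')%g (inord i) = v' (inord i.-1) by exact: sadjR.
  have L2 v' : (s i.+1 * v')%g (inord i) = v' (inord i.+1) by exact: sadjL.
  have R2 v' : (s i.+1 * v')%g (inord i.+1) = v' (inord i) by exact: sadjR.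
  have D1 v' : (s i * v')%g (inord i.+1) = v' (inord i.+1).
    by apply: sadjD; lia.
  have D2 v' : (s i.+1 * v')%g (inord i.-1) = v' (inord i.-1).
    by apply: sadjD; lia.
  have br : (s i * (s i.+1 * (s i * w)) = s i.+1 * (s i * (s i.+1 * w)))%g.
    by have := sadj_braid (proj1 (andP hi)) (proj2 (andP hj)); rewrite !mulgA => ->.
  have [z hz] := exists_desc_word (s i * (s i.+1 * (s i * w)))%g.
  move: di dj; rewrite /desc /= => di dj.
  have Di : desc_word [:: i.+1, i & z] (s i * w)%g.
    apply/and3P; split; [by []|by rewrite /desc /= !(L1, R1, L2, R2, D1, D2); lia|].
    by apply/and3P; split; [by []|by rewrite /desc /= !(L1, R1, L2, R2, D1, D2); lia|by []].
  have Dj : desc_word [:: i, i.+1 & z] (s i.+1 * w)%g.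
    apply/and3P; split; [by []|by rewrite /desc /= !(L1, R1, L2, R2, D1, D2); lia|].
    by apply/and3P; split; [by []|by rewrite /desc /= !(L1, R1, L2, R2, D1, D2); lia|by rewrite -br].
  by rewrite (IHi _ _ hu Di) (IHj _ _ hv Dj) /= hecke_op_braid //; lia.
Qed.

Variable rw : 'S_n -> seq nat.
Hypothesis rw_desc : forall w, desc_word (rw w) w.

Definition hecke_sym (G : V) : V := \sum_(w : 'S_n) hecke_word (rw w) G.

(** The permutations pair off as [w] and [sadj j * w] with [j] not a descent of [w], and by
    [matsumoto] the second term of a pair is [T_j] of the first. So the sum lies in the image of
    [1 + T_j], and [T_j (1 + T_j) = q (1 + T_j)] by the quadratic relation. *)
Lemma hecke_op_sym j G : (0 < j < n)%N -> hecke_op j (hecke_sym G) = [ffun w => q * hecke_sym G w].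
Proof.
move=> hj; rewrite /hecke_sym.
have -> : \sum_w hecke_word (rw w) G =
  \sum_(w | ~~ desc j w) (hecke_word (rw w) G + hecke_op j (hecke_word (rw w) G)).
  rewrite big_split /= [LHS](bigID (desc j)) /= addrC; congr (_ + _).
  rewrite (reindex_inj (can_inj (sadjK j))) /=.
  apply: eq_big => [w|w]; first by rewrite desc_sadj.
  move=> hd; apply: (@matsumoto _ (j :: rw w) _ G (rw_desc _)).
  by rewrite /= hj sadjK rw_desc hd.
rewrite hecke_op_sum.
have -> (Z : 'S_n -> V) (P : pred 'S_n) :
    [ffun w => q * (\sum_(i | P i) Z i) w] = \sum_(i | P i) [ffun w => q * Z i w].
  by apply/ffunP => w; rewrite ffunE !sum_ffunE mulr_sumr; apply: eq_bigr => i _; rewrite ffunE.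
apply: eq_bigr => w _; move: (hecke_word _ _) => Z.
have -> : Z + hecke_op j Z = \sum_(b : bool) (if b then Z else hecke_op j Z) by rewrite big_bool.
rewrite hecke_op_sum big_bool /= hecke_op_quad //.
by apply/ffunP => v; rewrite !ffunE big_bool /= !ffunE; ring.
Qed.

(** Cleared of denominators, the eigenvalue equation [T_j H = q H] reads [(xp j.-1 w - q * xp j w) *
    (H (s j * w) - H w) = 0], and the first factor is nonzero by [x_qneq]. *)
Lemma hecke_sym_sadj j G (w : 'S_n) : (0 < j < n)%N -> hecke_sym G (s j * w)%g = hecke_sym G w.
Proof.
move=> hj; have /ffunP/(_ w) := hecke_op_sym G hj; rewrite !ffunE.
have : xp j.-1 w - xp j w != 0 by apply: xp_sub_neq0; lia.
have : xp j.-1 w - q * xp j w != 0.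
  by apply: x_qneq; rewrite (inj_eq perm_inj) inord_pred_neq.
move: (xp j.-1 w) (xp j w) (hecke_sym G w) (hecke_sym G (s j * w)%g) => b a c d h1 h2.
move=> /(congr1 (fun t => (b - a) * t)) e; apply/eqP; rewrite -subr_eq0.
suff : (b - q * a) * (d - c) == 0 by rewrite mulf_eq0 (negPf h1).
apply/eqP; transitivity ((b - a) * ((q - 1) * ((b * c - a * d) / (b - a)) + d) - (b - a) * (q * c)).
  by field.
by rewrite e subrr.
Qed.

Lemma hecke_sym_const G (w : 'S_n) : hecke_sym G w = hecke_sym G 1%g.
Proof.
have [vu <-] := desc_word_prod (rw_desc w); elim: (rw w) vu => //= j u IH /andP[hj /IH <-].
by rewrite sperm_sadj // hecke_sym_sadj.
Qed.

(** * Expansion of the symmetrizer on indicator functions *)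

Local Notation delta v := ([ffun w => (w == v)%:R] : V).

(** Expanding the operators gives a sum over subwords of [u] that spell [t]. Such a subword has at
    least [plen t] letters, so it is all of [u], which does not spell [t]. *)
Lemma hecke_word_delta_eq0 u v (t : 'S_n) : valid_word n u -> (size u <= plen t)%N ->
  word_prod n u != t -> hecke_word u (delta v) (t * v)%g = 0.
Proof.
elim: u t => [|j u IH] t /=.
  by move=> _ _ ht; rewrite ffunE -[in X in _ == X](mul1g v) (inj_eq (mulIg v)) eq_sym (negPf ht).
case/andP => hj vu hs; rewrite sperm_sadj // => hne.
have e1 : hecke_word u (delta v) (s j * t * v)%g = 0.
  apply: IH => //; first by have := plen_sadj_ge t hj; lia.
  by apply: contra hne => /eqP ->; rewrite sadjK.
have e2 : hecke_word u (delta v) (t * v)%g = 0.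
  apply: IH => //; first exact: ltnW.
  by apply/eqP => e; have := size_word_prod_ge vu; rewrite e; lia.
by rewrite hecke_opE // mulgA e1 e2 !mulr0 addr0.
Qed.

Definition hecke_factor (v : 'S_n) (p : 'I_n * 'I_n) : K :=
  (q * x (v p.1) - x (v p.2)) / (x (v p.1) - x (v p.2)).

(** Only the full word contributes, by [hecke_word_delta_eq0]. Each letter brings the coefficient of
    [G (s j * w)] in [hecke_opE], which is the factor of the inversion that the letter creates. *)
Lemma hecke_word_delta_lead u v (t : 'S_n) : desc_word u t ->
  hecke_word u (delta v) (t * v)%g = \prod_(p in invset t) hecke_factor v p.
Proof.
elim: u t => [|j u IH] t /=.
  move=> /eqP ->; rewrite ffunE mul1g eqxx big1 // => p.
  by rewrite !inE invg1 !perm1; lia.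
case/and3P => hj hd hu; have [vu pu] := desc_word_prod hu.
have e0 : hecke_word u (delta v) (t * v)%g = 0.
  apply: hecke_word_delta_eq0 => //; first by rewrite (plen_desc hj hd) (desc_word_size hu).
  by apply/eqP => e; have := size_word_prod_ge vu; rewrite e (plen_desc hj hd) (desc_word_size hu) ltnn.
rewrite hecke_opE // mulgA e0 (IH _ hu).
have [-> hni] := invset_desc hj hd; rewrite big_setU1 //= mulr0 add0r; congr (_ * _).
have : xp j.-1 (t * v)%g - xp j (t * v)%g != 0 by apply: xp_sub_neq0; lia.
rewrite /hecke_factor /= !permM; move: (x _) (x _) => a b h.
by field; rewrite h subr_neq0C.
Qed.

Definition longest : 'S_n := perm (@rev_ord_inj n).

Lemma invset_longest : invset longest = [set p : 'I_n * 'I_n | (p.1 < p.2)%N].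
Proof.
apply/setP => -[c d]; rewrite !inE /=.
have h (i : 'I_n) : (longest^-1)%g i = rev_ord i.
  by apply: (@perm_inj _ longest); rewrite permKV permE rev_ordK.
rewrite !h /=; have := ltn_ord c; have := ltn_ord d; lia.
Qed.

(* The symmetrized function is constant, so it may be evaluated at [longest * v], where only
   the summand of the longest permutation survives. *)
Lemma hecke_sym_delta v w : hecke_sym (delta v) w = \prod_(p : 'I_n * 'I_n | (p.1 < p.2)%N) hecke_factor v p.
Proof.
rewrite hecke_sym_const -(hecke_sym_const _ (longest * v)%g) /hecke_sym sum_ffunE (bigD1 longest) //=.
rewrite hecke_word_delta_lead // invset_longest [X in _ + X]big1 ?addr0.
  by apply: eq_bigl => p; rewrite inE.
move=> t ht; have [vu pu] := desc_word_prod (rw_desc t).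
apply: hecke_word_delta_eq0; rewrite ?pu //.
rewrite (desc_word_size (rw_desc t)) /plen invset_longest; apply: subset_leq_card.
by apply/subsetP => p; rewrite !inE => /andP[].
Qed.

Lemma hecke_word_delta_sum u (G : V) :
  hecke_word u G = \sum_v [ffun w => G v * hecke_word u (delta v) w].
Proof.
elim: u => [|j u IH] /=.
  apply/ffunP => w; rewrite sum_ffunE (bigD1 w) //= !ffunE eqxx mulr1 big1 ?addr0 //.
  by move=> v hv; rewrite !ffunE eq_sym (negPf hv) mulr0.
by rewrite IH hecke_op_sum; apply: eq_bigr => v _; rewrite hecke_op_scale.
Qed.

Theorem hecke_symE (G : V) w :
  hecke_sym G w = \sum_v G v * \prod_(p : 'I_n * 'I_n | (p.1 < p.2)%N) hecke_factor v p.
Proof.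
rewrite {1}/hecke_sym; under eq_bigr do rewrite hecke_word_delta_sum.
rewrite exchange_big /= sum_ffunE; apply: eq_bigr => v _.
rewrite -(hecke_sym_delta v w) /hecke_sym !sum_ffunE mulr_sumr.
by apply: eq_bigr => t _; rewrite ffunE.
Qed.

End Hecke.

(** * Alternants *)

Section PairProducts.
Variable R : comNzRingType.

Fixpoint pairprod (T : Type) (r : T -> T -> R) (l : seq T) : R :=
  if l is a :: l' then (\prod_(b <- l') r a b) * pairprod r l' else 1.

Definition seqvdm : seq R -> R := pairprod (fun a b => a - b).

(* [seqnum] runs over the pairs that are not adjacent in the sequence, [seqadj] over the
   adjacent ones. *)
Fixpoint seqnum (q : R) (l : seq R) : R :=
  if l is a :: l' then (\prod_(b <- behead l') (q * a - b)) * seqnum q l' else 1.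

Fixpoint seqadj (q : R) (l : seq R) : R :=
  if l is a :: l' then (if l' is b :: _ then q * a - b else 1) * seqadj q l' else 1.

Lemma seqnum_adj q l : seqnum q l * seqadj q l = pairprod (fun a b => q * a - b) l.
Proof.
elim: l => [|a [|b l] IH] /=; first by rewrite mulr1.
  by rewrite !big_nil !mulr1.
by rewrite /= in IH; rewrite -IH big_cons; ring.
Qed.

Lemma seqadj_nth q l :
  seqadj q l = \prod_(0 <= i < (size l).-1) (q * nth 0 l i - nth 0 l i.+1).
Proof.
elim: l => [|a [|b l] IH]; first by rewrite big_geq.
  by rewrite big_geq //= mulr1.
by rewrite /= in IH *; rewrite big_nat_recl //= IH.
Qed.

Lemma pairprod_ord (T : Type) (r : T -> T -> R) n (x : 'I_n -> T) :
  pairprod r [seq x i | i <- enum 'I_n] =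
  \prod_(p : 'I_n * 'I_n | (p.1 < p.2)%N) r (x p.1) (x p.2).
Proof.
rewrite -(pair_big_dep xpredT (fun i j : 'I_n => (i < j)%N) (fun i j => r (x i) (x j))) /=.
elim: n x => [|n IH] x.
  by rewrite big_ord0 -[enum _]/(enum 'I_0) (size0nil (size_enum_ord 0)).
rewrite enum_ordSl /= -map_comp (IH (x \o lift ord0)) big_ord_recl; congr (_ * _).
  rewrite big_map big_enum [RHS]big_mkcond big_ord_recl /= mul1r.
  exact: eq_bigr.
apply: eq_bigr => i _.
by rewrite [RHS]big_mkcond big_ord_recl /= mul1r big_mkcond.
Qed.

End PairProducts.

Section Morphisms.
Variables (R S : comNzRingType) (f : {rmorphism R -> S}).

Lemma rmorph_seqvdm l : f (seqvdm l) = seqvdm (map f l).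
Proof.
elim: l => [|a l IH] /=; first exact: rmorph1.
rewrite /seqvdm /= -!/(seqvdm _) rmorphM IH rmorph_prod big_map; congr (_ * _).
by apply: eq_bigr => b _; rewrite rmorphB.
Qed.

Lemma rmorph_seqnum q l : f (seqnum q l) = seqnum (f q) (map f l).
Proof.
elim: l => [|a l IH] /=; first exact: rmorph1.
rewrite rmorphM IH rmorph_prod behead_map big_map; congr (_ * _).
by apply: eq_bigr => b _; rewrite rmorphB rmorphM.
Qed.

Lemma rmorph_seqadj q l : f (seqadj q l) = seqadj (f q) (map f l).
Proof.
elim: l => [|a [|b l] IH] /=; first exact: rmorph1.
  by rewrite !rmorphM !rmorph1.
by rewrite rmorphM IH rmorphB rmorphM.
Qed.

End Morphisms.

Section Alternants.

Definition npairs n := #|[pred p : 'I_n * 'I_n | (p.1 < p.2)%N]|.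

Lemma seqvdm_det (R : comNzRingType) n (x : 'I_n -> R) :
  seqvdm [seq x i | i <- enum 'I_n] =
  (-1) ^+ npairs n * \det (Vandermonde n (\row_j x j)).
Proof.
rewrite /seqvdm pairprod_ord det_Vandermonde pair_big_dep /= /npairs -prodrN.
by apply: eq_big => // -[i j] _ /=; rewrite !mxE opprB.
Qed.

Lemma seqvdm_perm (R : comNzRingType) n (x : 'I_n -> R) (w : 'S_n) :
  seqvdm [seq x (w i) | i <- enum 'I_n] =
  (-1) ^+ w * seqvdm [seq x i | i <- enum 'I_n].
Proof.
rewrite (seqvdm_det (fun i => x (w i))) (seqvdm_det x).
have -> : Vandermonde n (\row_j x (w j)) = col_perm w (Vandermonde n (\row_j x j)).
  by apply/matrixP => i j; rewrite !mxE.
by rewrite col_permE det_mulmx det_perm odd_permV [LHS]mulrA [LHS]mulrC.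
Qed.

Lemma seqvdm_neq0 (R : idomainType) n (x : 'I_n -> R) : injective x ->
  seqvdm [seq x i | i <- enum 'I_n] != 0.
Proof.
move=> xi; rewrite /seqvdm pairprod_ord; apply/prodf_neq0 => -[i j] /= hij.
by rewrite subr_eq0 (inj_eq xi) -val_eqE /=; lia.
Qed.

(** Sorted, the values increase strictly, so the [k]-th is at least [k]; as the sum is the least
    possible, they are exactly [0, .., n - 1]. *)
Lemma inj_sum_bound n (e : 'I_n -> nat) : injective e ->
  (\sum_i e i)%N = 'C(n, 2) -> forall i, (e i < n)%N.
Proof.
move=> ei es.
pose l := sort leq [seq e i | i <- enum 'I_n].
have sl : size l = n by rewrite size_sort size_map size_enum_ord.
have sorted_l : sorted ltn l.
  rewrite ltn_sorted_uniq_leq sort_uniq map_inj_uniq // enum_uniq /=.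
  by apply: sort_sorted; exact: leq_total.
have ge k : (k < n)%N -> (k <= nth 0%N l k)%N.
  elim: k => // k IH hk; apply: leq_ltn_trans (IH (ltnW hk)) _.
  by apply: (sorted_ltn_nth ltn_trans) => //; rewrite inE sl //; exact: ltnW.
have ge' (i : 'I_n) : true -> (i <= nth 0%N l i ?= iff (i == nth 0%N l i :> nat))%N.
  by move=> _; split=> //; exact: ge.
have [_] := leqif_sum ge'.
have -> : (\sum_(i < n) nth 0%N l i)%N = (\sum_i e i)%N.
  transitivity (\sum_(i <- l) i)%N.
    by rewrite (big_nth 0%N) big_mkord sl.
  rewrite /l (perm_big [seq e i | i <- enum 'I_n]) ?perm_sort //= big_map big_enum /=.
  exact: eq_bigr.
rewrite es -bin2_sum big_mkord eqxx => /esym/forallP h i.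
have : e i \in l by rewrite mem_sort map_f // mem_enum.
move=> /(nthP 0%N)[k]; rewrite sl => hk <-.
by have /eqP <- := h (Ordinal hk).
Qed.

(* The integer [c] does not depend on the ring nor on the point; it is [0] or a sign. *)
Lemma alternant_monomial n (e : 'I_n -> nat) : (\sum_i e i)%N = 'C(n, 2) ->
  exists c : int, forall (R : comNzRingType) (x : 'I_n -> R),
  \sum_(w : 'S_n) (-1) ^+ w * \prod_i x (w i) ^+ e i =
  c%:~R * seqvdm [seq x i | i <- enum 'I_n].
Proof.
move=> es.
(* A generalized Vandermonde determinant: distinct exponents with this sum permute [0, .., n - 1]
   and give a signed Vandermonde determinant, while a repeated exponent gives two equal rows. *)
have detE (R : comNzRingType) (x : 'I_n -> R) :
    \sum_(w : 'S_n) (-1) ^+ w * \prod_i x (w i) ^+ e i =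
    \det (\matrix_(i, j) x j ^+ e i).
  apply: eq_bigr => w _; congr (_ * _).
  by apply: eq_bigr => i _; rewrite mxE.
case: (boolP (injectiveb e)) => [/injectiveP ei|/injectivePn[i [j hij eij]]].
  have hb := inj_sum_bound ei es.
  have si : injective (fun i => Ordinal (hb i)) by move=> i j [] /ei.
  exists ((-1) ^+ perm si * (-1) ^+ npairs n) => R x.
  rewrite detE seqvdm_det.
  have -> : \matrix_(i, j) x j ^+ e i = row_perm (perm si) (Vandermonde n (\row_j x j)).
    by apply/matrixP => i j; rewrite !mxE permE.
  rewrite row_permE det_mulmx det_perm rmorphM !rmorph_sign /=.
  by rewrite -[RHS]mulrA [X in _ = _ * X]mulrA -expr2 sqrr_sign mul1r.
exists 0 => R x; rewrite detE mul0r (determinant_alternate hij) // => k.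
by rewrite !mxE eij.
Qed.

End Alternants.

(** * Symmetrized quotients by the Vandermonde product *)

Section SymmetrizedQuotient.
Variables (n : nat) (k : fieldType).

Lemma msym_monomial (w : 'S_n) (e : 'X_{1..n}) :
  msym w ('X_[e] : {mpoly k[n]}) = \prod_i 'X_(w i) ^+ e i.
Proof.
rewrite msymX mpolyXE_id (reindex_inj (@perm_inj _ w)) /=.
by apply: eq_bigr => i _; rewrite mnmE permK.
Qed.

Lemma meval_msym (w : 'S_n) (p : {mpoly k[n]}) x :
  (msym w p).@[x] = p.@[fun i => x (w i)].
Proof.
rewrite {1}(mpolyE p) (big_morph _ (msymD w) (msym0 _ w)) raddf_sum [RHS]mevalE /=; apply: eq_bigr => e _.
rewrite msymZ mevalZ msym_monomial rmorph_prod; congr (_ * _).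
by apply: eq_bigr => i _; rewrite rmorphXn /= mevalXU.
Qed.

Local Notation Xs := [seq 'X_i : {mpoly k[n]} | i <- enum 'I_n].

Lemma alternant_homog (F : {mpoly k[n]}) : F \is 'C(n, 2).-homog ->
  exists c : k, \sum_(w : 'S_n) (-1) ^+ w * msym w F = c%:MP * seqvdm Xs.
Proof.
move=> /dhomogP hF; have := mpolyE F; rewrite big_seq => eF; rewrite eF {eF}.
apply: (big_ind (fun G => exists c : k,
  \sum_(w : 'S_n) (-1) ^+ w * msym w G = c%:MP * seqvdm Xs))
  => [|a b [c hc] [d hd]|e he].
- exists 0; rewrite mul0r big1 // => w _; by rewrite msym0 mulr0.
- exists (c + d); rewrite rmorphD mulrDl -hc -hd -big_split /=.
  by apply: eq_bigr => w _; rewrite msymD mulrDr.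
- have [|c hc] := @alternant_monomial n e; first by rewrite -mdegE; exact: hF.
  exists (F@_e * c%:~R).
  rewrite mpolyCM -mulrA rmorph_int -hc mulr_sumr; apply: eq_bigr => w _.
  by rewrite msymZ msym_monomial -mul_mpolyC mulrCA.
Qed.

Lemma seqnum_homog (q : k) (l : seq {mpoly k[n]}) :
  {in l, forall a, a \is 1.-homog} -> seqnum q%:MP l \is 'C((size l).-1, 2).-homog.
Proof.
elim: l => [_|a l IH hl] /=; first exact: dhomog1.
have {}IH := IH (fun b hb => hl b (mem_behead (s := a :: l) hb)).
have hP (s : seq {mpoly k[n]}) : {in s, forall b, b \is 1.-homog} ->
    \prod_(b <- s) (q%:MP * a - b) \is (size s).-homog.
  elim: s => [_|b s IHs hs]; first by rewrite big_nil dhomog1.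
  rewrite big_cons /= -(add1n (size s)); apply: dhomogM.
    by rewrite rpredB ?(hs b) ?mem_head // mul_mpolyC dhomogZ // hl ?mem_head.
  by apply: IHs => c hc; apply: hs; rewrite inE hc orbT.
have {}hP : \prod_(b <- behead l) (q%:MP * a - b) \is (size l).-1.-homog.
  rewrite -size_behead; apply: hP => b /mem_behead hb.
  by apply: hl; rewrite inE hb orbT.
case: (l) hP IH => [|b l'] /= hP IH; first by rewrite big_nil mul1r.
by rewrite binS bin1 addnC; exact: dhomogM.
Qed.

(** The value at [x] of [\sum_w w (p * \prod_(i + 1 < j) (q x_i - x_j) / Delta)], taken in [k]
    rather than in the fraction field so that a coordinate can be specialized to [0]. *)
Definition phi (q : k) (x : 'I_n -> k) (p : {mpoly k[n]}) : k :=
  \sum_(w : 'S_n) p.@[fun i => x (w i)] *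
    (seqnum q [seq x (w i) | i <- enum 'I_n] / seqvdm [seq x (w i) | i <- enum 'I_n]).

(** The numerator has degree [(n - 1) + 'C(n - 1, 2) = 'C(n, 2)], that of the Vandermonde product.
    The polynomial identity serves the bracket; the same scalar at all points permits a change of
    point. *)
Lemma alternant_constant (q : k) (p : {mpoly k[n]}) : (0 < n)%N -> p \is n.-1.-homog ->
  exists c : k,
    \sum_(w : 'S_n) (-1) ^+ w * msym w (p * seqnum q%:MP Xs) = c%:MP * seqvdm Xs /\
    forall x : 'I_n -> k, injective x -> phi q x p = c.
Proof.
move=> n0 hp.
have [|c hc] := @alternant_homog (p * seqnum q%:MP Xs).
  have -> : 'C(n, 2) = (n.-1 + 'C(n.-1, 2))%N.
    by rewrite -{1}(prednK n0) binS bin1 addnC.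
  apply: dhomogM => //; have := @seqnum_homog q Xs; rewrite size_map size_enum_ord; apply.
  by move=> a /mapP[i _ ->]; rewrite dhomogX /= mdeg1.
exists c; split=> // x xi.
have hv := seqvdm_neq0 xi.
apply: (mulIf hv).
have eX y : map (meval y) Xs = [seq y i | i <- enum 'I_n].
  by rewrite -map_comp; apply: eq_map => i; rewrite /= mevalXU.
have := congr1 (meval x) hc; rewrite rmorphM /= mevalC rmorph_seqvdm eX.
move=> <-; rewrite raddf_sum /= /phi mulr_suml; apply: eq_bigr => w _.
rewrite rmorphM /= rmorph_sign meval_msym rmorphM /= rmorph_seqnum /= mevalC eX.
rewrite seqvdm_perm; move: (meval _ _) (seqnum _ _) (seqvdm _) hv => a b d hd.
by rewrite invfM -signr_odd; case: (odd _); rewrite ?expr0 ?expr1 ?invr1 ?invrN1; field.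
Qed.

End SymmetrizedQuotient.

(** * Inserting a zero coordinate *)

Section InsertDefault.
Variables (T : Type) (d : T).

Definition insert_at n (t : 'I_n.+1) (z : 'I_n -> T) (i : 'I_n.+1) : T :=
  if unlift t i is Some j then z j else d.

Lemma insert_at_seq n (t : 'I_n.+1) (z : 'I_n -> T) :
  [seq insert_at t z i | i <- enum 'I_n.+1] =
  take t [seq z i | i <- enum 'I_n] ++ d :: drop t [seq z i | i <- enum 'I_n].
Proof.
have sz k (v : 'I_k -> T) : size [seq v i | i <- enum 'I_k] = k.
  by rewrite size_map size_enum_ord.
have st : size (take t [seq z i | i <- enum 'I_n]) = t.
  by rewrite size_takel // size_map size_enum_ord -ltnS.
apply: (@eq_from_nth _ d).
  rewrite size_cat st -(cat1s d) size_cat size_drop !sz.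
  by have := ltn_ord t; rewrite /=; lia.
move=> k; rewrite size_map size_enum_ord => hk.
rewrite (nth_map t) ?size_enum_ord // nth_cat st.
rewrite -[nth t _ k]/(nth t _ (Ordinal hk)) nth_ord_enum /insert_at.
case: unliftP => [j|] e.
  have -> : k = bump t j by have := congr1 val e.
  rewrite /bump; case: (leqP t j) => htj.
    rewrite ifF; last by lia.
    have -> : (1 + j - t)%N = (j - t).+1 by lia.
    rewrite /= nth_drop subnKC // (nth_map j) ?size_enum_ord //.
    by rewrite nth_ord_enum.
  by rewrite add0n htj nth_take // (nth_map j) ?size_enum_ord // nth_ord_enum.
have -> : k = t by have := congr1 val e.
by rewrite ltnn subnn.
Qed.

End InsertDefault.

Section Insertion.
Variables (K : fieldType) (q : K).

Definition seqwt (l : seq K) : K := seqnum q l / seqvdm l.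

Lemma seqwt_cons a l :
  seqwt (a :: l) = (\prod_(b <- behead l) (q * a - b)) / (\prod_(b <- l) (a - b)) * seqwt l.
Proof.
rewrite /seqwt /seqvdm /= -!/(seqvdm _) invfM; move: (seqnum q l) (seqvdm l)^-1 => u v.
by rewrite mulrACA.
Qed.

(** Let [u] be the last entry before the [0] and [h] the first after it. Every other earlier entry
    contributes [q], every other later entry [1], and the pair [(u, h)] stops being adjacent. The
    resulting factor [q ^+ (size l1 - 1) * (q u - h) / (- u h)] splits by partial fractions into the
    two terms; a missing neighbour drops its term. *)
Lemma seqwt_insert0 (l1 l2 : seq K) : all (fun a => a != 0) (l1 ++ l2) ->
  (0 < size (l1 ++ l2))%N ->
  seqwt (l1 ++ 0 :: l2) = seqwt (l1 ++ l2) *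
    ((if l1 is a :: l then q ^+ size l / last a l else 0) -
     (if l2 is h :: _ then q ^+ size l1 / h else 0)).
Proof.
elim: l1 => [|a l1 IH] /=.
  case: l2 => [|h t] //= /andP[h0 t0] _.
  rewrite seqwt_cons /= big_cons.
  have -> : \prod_(b <- t) (q * 0 - b) = \prod_(b <- t) (0 - b).
    by apply: eq_bigr => b _; rewrite mulr0.
  have : \prod_(b <- t) (0 - b) != 0.
    rewrite prodf_seq_neq0; apply/allP => b hb /=.
    by rewrite sub0r oppr_eq0; exact: (allP t0).
  rewrite sub0r; move: (\prod_(b <- t) _) => u hu.
  by field; rewrite oppr_eq0 hu h0.
case/andP => a0 h _; rewrite !seqwt_cons.
case: l1 IH h => [|c l1] IH h.
  rewrite /= seqwt_cons expr0 expr1.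
  case: l2 {IH} h => [|h t] /=.
    by rewrite !big_cons !big_nil; move: (seqwt [::]) => v _; field; rewrite a0 oner_neq0.
  case/andP => h0 t0.
  have -> : \prod_(b <- t) (q * 0 - b) = \prod_(b <- t) (0 - b).
    by apply: eq_bigr => b _; rewrite mulr0.
  rewrite !big_cons.
  have : \prod_(b <- t) (0 - b) != 0.
    rewrite prodf_seq_neq0; apply/allP => b hb /=.
    by rewrite sub0r oppr_eq0; exact: (allP t0).
  rewrite sub0r subr0 !invfM.
  move: (\prod_(b <- t) (0 - b)) (\prod_(b <- t) (q * a - b)) => u v hu.
  move: ((a - h)^-1) (\prod_(b <- t) (a - b))^-1 => d e.
  by field; rewrite ?oppr_eq0 hu h0 a0.
rewrite IH //= !big_cons !big_cat /= !big_cons !subr0 !invfM !exprS.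
have -> : (if l2 is h0 :: _ then q * (q * q ^+ size l1) / h0 else 0)
    = q * (if l2 is h0 :: _ then q * q ^+ size l1 / h0 else 0).
  by case: (l2) => [|h0 l]; rewrite ?mulr0 // !mulrA.
move: (if l2 is h0 :: _ then q * q ^+ size l1 / h0 else 0) => B.
move: (seqwt _) (last c l1)^-1 (q ^+ _) => W L Q.
move: (\prod_(i <- l1) (q * a - i)) (\prod_(i <- l2) (q * a - i)) => u1 u2.
move: (\prod_(i <- l1) (a - i))^-1 (\prod_(i <- l2) (a - i))^-1 (a - c)^-1 => d1 d2 e.
by field.
Qed.

Lemma seqwt_insert_at n (t : 'I_n.+1) (z : 'I_n -> K) : (0 < n)%N -> (forall i, z i != 0) ->
  seqwt [seq insert_at 0 t z i | i <- enum 'I_n.+1] = seqwt [seq z i | i <- enum 'I_n] *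
   ((if (t : nat) is t'.+1 then q ^+ t' / nth 0 [seq z i | i <- enum 'I_n] t' else 0) -
    (if (t < n)%N then q ^+ t / nth 0 [seq z i | i <- enum 'I_n] t else 0)).
Proof.
move=> n0 hz; rewrite insert_at_seq seqwt_insert0 ?cat_take_drop; last 2 first.
- by apply/allP => a /mapP[i _ ->].
- by rewrite size_map size_enum_ord.
have sz : size [seq z i | i <- enum 'I_n] = n by rewrite size_map size_enum_ord.
move: [seq z i | i <- enum 'I_n] sz => l sz; have := ltn_ord t; move: (nat_of_ord t) => {}t ht.
have st : size (take t l) = t by rewrite size_takel // sz -ltnS.
congr (_ * (_ - _)).
  case: t ht st => [|t] ht; first by rewrite take0.
  case e : (take t.+1 l) => [|a l'] //= [st]; rewrite st; congr (_ / _).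
  by rewrite -[last a l']/(last 0 (a :: l')) -e -nth_last e /= st -[in RHS](cat_take_drop t.+1 l)
    e nth_cat /= st leqnn.
rewrite st; case: (ltnP t n) => htn; last by rewrite drop_oversize // sz.
by rewrite (drop_nth 0) // sz.
Qed.

(** Summation by parts: [q ^+ s / z s] occurs twice, with sign [+] for the [0] inserted just after
    [z s] and with sign [-] for the [0] inserted just before it. *)
Lemma sum_insert_at n (p : ('I_n.+1 -> K) -> K) (z : 'I_n -> K) :
  (0 < n)%N -> (forall i, z i != 0) ->
  \sum_(t < n.+1) p (insert_at 0 t z) * seqwt [seq insert_at 0 t z i | i <- enum 'I_n.+1] =
  \sum_(s < n) q ^+ s * ((p (insert_at 0 (lift ord0 s) z) - p (insert_at 0 (widen_ord (leqnSn n) s) z)) / z s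
     * seqwt [seq z i | i <- enum 'I_n]).
Proof.
move=> n0 hz.
have [u [hu h]] : exists u : nat -> K, (forall s : 'I_n, u s = q ^+ s / z s) /\
    forall t : 'I_n.+1, seqwt [seq insert_at 0 t z i | i <- enum 'I_n.+1] =
      seqwt [seq z i | i <- enum 'I_n] *
      ((if (t : nat) is t'.+1 then u t' else 0) - (if (t < n)%N then u t else 0)).
  exists (fun s => q ^+ s / nth 0 [seq z i | i <- enum 'I_n] s); split=> [s|t].
    by rewrite (nth_map s) ?size_enum_ord // nth_ord_enum.
  exact: seqwt_insert_at.
move: (seqwt [seq z i | i <- enum 'I_n]) h => W h.
under eq_bigr do rewrite h !mulrBr.
rewrite sumrB big_ord_recl big_ord_recr /= ltnn !mulr0 add0r addr0 -sumrB.
by apply: eq_bigr => s _; rewrite ltn_ord hu; ring.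
Qed.

Lemma sum_perm_lift n (F : 'S_n.+1 -> K) :
  \sum_(w : 'S_n.+1) F w = \sum_(t < n.+1) \sum_(w : 'S_n) F (lift_perm t ord_max w).
Proof.
rewrite (partition_big (fun w : 'S_n.+1 => (w^-1)%g ord_max) xpredT) //=.
apply: eq_bigr => t _.
have ext (w : 'S_n.+1) : ((w^-1)%g ord_max == t) = (w t == ord_max).
  by rewrite (canF_eq (permKV w)) eq_sym.
rewrite (eq_bigl _ _ ext) (reindex (lift_perm t ord_max)) /=.
  by apply: eq_bigl => w; rewrite lift_perm_id eqxx.
(* Inverse of [lift_perm]: the position [i] and its value [s i] are deleted. The default of [odflt]
   is never reached, since [s (lift i k)] differs from [s i]. *)
pose ulsf i (s : 'S_n.+1) k := odflt k (unlift (s i) (s (lift i k))).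
have ulsfK i (s : 'S_n.+1) k : lift (s i) (ulsf i s k) = s (lift i k).
  rewrite /ulsf; have := neq_lift i k.
  by rewrite -(can_eq (permK s)) => /unlift_some[] ? ? ->.
have inj_ulsf : injective (ulsf t _).
  move=> s; apply: can_inj (ulsf (s t) s^-1%g) _ => k'.
  by rewrite {1}/ulsf ulsfK !permK liftK.
exists (fun s => perm (inj_ulsf s)) => [s _ | s].
  by apply/permP => k'; rewrite permE /ulsf lift_perm_lift lift_perm_id liftK.
move/(s _ =P _) => si0; apply/permP => k.
case: (unliftP t k) => [k'|] ->; rewrite ?lift_perm_id //.
by rewrite lift_perm_lift -si0 permE ulsfK.
Qed.

(** A permutation sending the position [t] to [ord_max] puts the coordinate [0] in position [t]. So
    the sum runs over the insertions of [0] into permuted copies of [y], and [sum_insert_at] applies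
    to each copy. *)
Lemma phi_trim n (y : 'I_n -> K) (p : {mpoly K[n.+1]}) (g : 'I_n -> {mpoly K[n]}) :
  (0 < n)%N -> (forall i, y i != 0) ->
  (forall s z, (forall i, z i != 0) -> z s * (g s).@[z] =
     p.@[insert_at 0 (lift ord0 s) z] - p.@[insert_at 0 (widen_ord (leqnSn n) s) z]) ->
  phi q (insert_at 0 ord_max y) p = \sum_(s < n) q ^+ s * phi q y (g s).
Proof.
move=> n0 hy hg; rewrite /phi sum_perm_lift.
have insE (t : 'I_n.+1) (w : 'S_n) :
    (fun i => insert_at 0 ord_max y (lift_perm t ord_max w i)) =1 insert_at 0 t (fun i => y (w i)).
  move=> i; case: (unliftP t i) => [j|] ->.
    by rewrite lift_perm_lift /insert_at !liftK.
  by rewrite lift_perm_id /insert_at !unlift_none.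
under eq_bigr do under eq_bigr do rewrite (meval_eq _ (insE _ _)) (eq_map (insE _ _)).
rewrite exchange_big /=.
under eq_bigr => w _ do rewrite (@sum_insert_at n (fun x => p.@[x])) //.
rewrite exchange_big /=; apply: eq_bigr => s _; rewrite mulr_sumr.
apply: eq_bigr => w _; rewrite -hg //; congr (_ * _); rewrite /seqwt.
by rewrite [_ * (g s).@[_]]mulrC mulfK.
Qed.

End Insertion.

(** * Trimming monomials and quasisymmetric polynomials *)

Section Monomials.
Variable n : nat.
Implicit Types (t : 'I_n.+1) (s i : 'I_n) (m : 'X_{1..n.+1}).

Definition mdel t m : 'X_{1..n} := [multinom m (lift t j) | j < n].
Definition mins t (m : 'X_{1..n}) : 'X_{1..n.+1} := [multinom insert_at 0%N t m j | j < n.+1].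

Lemma mins_eqE t m (m' : 'X_{1..n}) : (m == mins t m') = (m t == 0%N) && (mdel t m == m').
Proof.
apply/eqP/andP => [->|[/eqP mt /eqP <-]].
  rewrite mnmE /insert_at unlift_none eqxx; split=> //; apply/eqP/mnmP => j.
  by rewrite !mnmE /insert_at liftK.
apply/mnmP => j; rewrite mnmE /insert_at; case: unliftP => [i|] -> //.
by rewrite mnmE.
Qed.

Lemma mdeg_mdel t m : m t = 0%N -> mdeg (mdel t m) = mdeg m.
Proof.
move=> mt; rewrite !mdegE [RHS](bigD1_ord t) //= mt add0n.
by apply: eq_bigr => j _; rewrite mnmE.
Qed.

Lemma mdeg_mins t (m : 'X_{1..n}) : mdeg (mins t m) = mdeg m.
Proof.
have := mins_eqE t (mins t m) m; rewrite eqxx => /esym/andP[/eqP h /eqP e].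
by rewrite -(mdeg_mdel h) e.
Qed.

Lemma flat_mins t (m : 'X_{1..n}) : flat (mins t m) = flat m.
Proof.
rewrite /flat (eq_map (g := insert_at 0%N t m)); last by move=> i; rewrite mnmE.
by rewrite insert_at_seq filter_cat /= -filter_cat cat_take_drop.
Qed.

Lemma sum_mdel_ge t m i : m t = 0%N ->
  (\sum_(j : 'I_n | i <= j) mdel t m j = \sum_(j : 'I_n.+1 | lift t i <= j) m j)%N.
Proof.
move=> mt; rewrite [RHS]big_mkcond (bigD1_ord t) //= mt if_same add0n.
rewrite [LHS]big_mkcond; apply: eq_bigr => j _.
by rewrite mnmE leq_bump2.
Qed.

(** With one variable fewer, the bound at [i] is smaller by one. If [i < t], then [i <= s] and the
    subtracted [U_(s)] makes up for it; otherwise the tail starts at index [i + 1] of [m], where the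
    bound is already the smaller one. *)
Lemma ABB_mdel t s m : ((t == s :> nat) || (t == s.+1 :> nat)) ->
  m t = 0%N -> (0 < mdel t m s)%N -> ABB m -> ABB (mdel t m - U_(s))%MM.
Proof.
move=> hts mt hs /forallP hm; apply/forallP => i.
have := hm (lift t i); rewrite -sum_mdel_ge //=.
have -> : (\sum_(j : 'I_n | i <= j) mdel t m j =
   \sum_(j : 'I_n | i <= j) (mdel t m - U_(s))%MM j + (i <= s))%N.
  have e j : mdel t m j = ((mdel t m - U_(s))%MM j + (s == j))%N.
    rewrite mnmBE mnm1E; case: eqP => [<-|_]; last by rewrite subn0 addn0.
    by rewrite subnK.
  rewrite (eq_bigr _ (fun j _ => e j)) big_split /=; congr (_ + _)%N.
  rewrite big_mkcond (bigD1 s) //= eqxx big1 => [|j hj]; first by case: leq.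
  by rewrite eq_sym (negPf hj) if_same.
move: (\sum_(j | _) _)%N => S.
have := ltn_ord i; have := ltn_ord s; rewrite /bump => *; lia.
Qed.

Section Eval.
Variable k : fieldType.
Local Notation "''Y_[' m ]" := ('X_[m] : {mpoly k[_]}) (at level 8).

Lemma meval_monomial_ins t m (z : 'I_n -> k) :
  ('Y_[m]).@[insert_at 0 t z] = if m t == 0%N then ('Y_[mdel t m]).@[z] else 0.
Proof.
rewrite !mevalX (bigD1_ord t) //= /insert_at unlift_none expr0n.
case: (m t == 0%N); rewrite /= ?mul0r // mul1r.
by apply: eq_bigr => j _; rewrite liftK mnmE.
Qed.

Lemma meval_monomial_sub (m : 'X_{1..n}) s (z : 'I_n -> k) : (0 < m s)%N ->
  z s * ('Y_[m - U_(s)]).@[z] = ('Y_[m]).@[z].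
Proof.
move=> hs; have hle : (U_(s) <= m)%MM.
  by apply/mnm_lepP => j; rewrite mnm1E; case: eqP => // <-.
by rewrite -[in RHS](submK hle) mpolyXD mevalM mevalXU mulrC.
Qed.

(* [trim_coef s m *: 'X_[trim_mon s m]] is the trimming of ['X_[m]] at [s] (cf. [trim_monE]);
   [trim_mon] is only meaningful when [trim_coef] is nonzero. *)
Definition trim_coef s m : k :=
  (m (lift ord0 s) == 0%N)%:R - (m (widen_ord (leqnSn n) s) == 0%N)%:R.

Definition trim_mon s m : 'X_{1..n} :=
  ((if m (lift ord0 s) == 0%N then mdel (lift ord0 s) m
    else mdel (widen_ord (leqnSn n) s) m) - U_(s))%MM.

Lemma lift_succ s : lift (lift ord0 s) s = widen_ord (leqnSn n) s.
Proof. by apply: val_inj; rewrite /= /bump; lia. Qed.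

Lemma lift_same s : lift (widen_ord (leqnSn n) s) s = lift ord0 s.
Proof. by apply: val_inj; rewrite /= /bump; lia. Qed.

(** If the exponents at [s] and [s + 1] are both zero, the two insertions agree; if neither is, both
    terms vanish; otherwise one term survives and is divisible by [z s]. *)
Lemma trim_monE s m z :
  z s * (trim_coef s m * ('Y_[trim_mon s m]).@[z]) =
  ('Y_[m]).@[insert_at 0 (lift ord0 s) z] - ('Y_[m]).@[insert_at 0 (widen_ord (leqnSn n) s) z].
Proof.
rewrite !meval_monomial_ins /trim_coef /trim_mon.
case: (eqVneq (m (lift ord0 s)) 0%N) => h1;
  case: (eqVneq (m (widen_ord (leqnSn n) s)) 0%N) => h2.
- rewrite subrr mul0r mulr0; apply/esym/eqP; rewrite subr_eq0; apply/eqP.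
  congr (meval _ _); congr mpolyX; apply/mnmP => j; rewrite !mnmE.
  case: (ltngtP j s) => hj.
  + by congr (m _); apply: val_inj; rewrite /= /bump; lia.
  + by congr (m _); apply: val_inj; rewrite /= /bump; lia.
  + have -> : j = s by apply: val_inj.
    by rewrite lift_succ lift_same h1 h2.
- rewrite !subr0 mul1r meval_monomial_sub // mnmE lift_succ; lia.
- rewrite !sub0r mulN1r mulrN meval_monomial_sub // mnmE lift_same; lia.
- by rewrite !subrr mul0r mulr0.
Qed.

Lemma trim_mon_mdeg s m : trim_coef s m != 0 -> mdeg m = (mdeg (trim_mon s m)).+1.
Proof.
have aux t : m t = 0%N -> (0 < mdel t m s)%N -> mdeg m = (mdeg (mdel t m - U_(s))%MM).+1.
  move=> mt hs; have hle : (U_(s) <= mdel t m)%MM.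
    by apply/mnm_lepP => j; rewrite mnm1E; case: eqP => // <-.
  by rewrite -(mdeg_mdel mt) -[in LHS](submK hle) mdegD mdeg1 addn1.
rewrite /trim_coef /trim_mon; case: (eqVneq (m (lift ord0 s)) 0%N) => h1;
  case: (eqVneq (m (widen_ord (leqnSn n) s)) 0%N) => h2; rewrite ?subrr ?eqxx // => _.
- by apply: aux => //; rewrite mnmE lift_succ; lia.
- by apply: aux => //; rewrite mnmE lift_same; lia.
Qed.

Lemma trim_mon_ABB s m : trim_coef s m != 0 -> ABB m -> ABB (trim_mon s m).
Proof.
rewrite /trim_coef /trim_mon; case: (eqVneq (m (lift ord0 s)) 0%N) => h1;
  case: (eqVneq (m (widen_ord (leqnSn n) s)) 0%N) => h2; rewrite ?subrr ?eqxx // => _.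
- by apply: ABB_mdel => //; [apply/orP; right|rewrite mnmE lift_succ; lia].
- by apply: ABB_mdel => //; [apply/orP; left|rewrite mnmE lift_same; lia].
Qed.

Definition qres t (Q : {mpoly k[n.+1]}) : {mpoly k[n]} :=
  \sum_(m <- msupp Q | m t == 0%N) Q@_m *: 'X_[mdel t m].

Lemma mcoeff_qres t Q (m : 'X_{1..n}) : (qres t Q)@_m = Q@_(mins t m).
Proof.
rewrite /qres raddf_sum [in RHS](mpolyE Q) raddf_sum /= big_mkcond.
apply: eq_bigr => m' _; rewrite !mcoeffZ !mcoeffX mins_eqE.
by case: (m' t == 0%N); rewrite /= ?mulr0.
Qed.

Lemma meval_qres t Q z : (qres t Q).@[z] = Q.@[insert_at 0 t z].
Proof.
rewrite /qres [in RHS](mpolyE Q) !raddf_sum /= big_mkcond; apply: eq_bigr => m _.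
rewrite !mevalZ meval_monomial_ins; case: (m t == 0%N) => //.
by rewrite mulr0.
Qed.

Lemma quasisym_qres t Q : quasisym Q -> quasisym (qres t Q).
Proof. by move=> hQ m m' e; rewrite !mcoeff_qres; apply: hQ; rewrite !flat_mins. Qed.

Lemma qres_indep t t' Q : quasisym Q -> qres t Q = qres t' Q.
Proof. by move=> hQ; apply/mpolyP => m; rewrite !mcoeff_qres; apply: hQ; rewrite !flat_mins. Qed.

Lemma qres_homog d t (Q : {mpoly k[n.+1]}) : Q \is d.-homog -> qres t Q \is d.-homog.
Proof.
move=> /dhomogP hQ; apply/dhomogP => m; rewrite mcoeff_msupp mcoeff_qres -mcoeff_msupp.
by move/hQ => /= <-; rewrite mdeg_mins.
Qed.

End Eval.
End Monomials.

(** * Recursion on the number of variables *)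

Section Evaluation.
Variables (k : fieldType) (q : k).
Hypothesis hchar : [pchar k] =i pred0.

Lemma phiD n (x : 'I_n -> k) p r : phi q x (p + r) = phi q x p + phi q x r.
Proof. by rewrite /phi -big_split; apply: eq_bigr => w _; rewrite mevalD mulrDl. Qed.

Lemma phiZ n (x : 'I_n -> k) c p : phi q x (c *: p) = c * phi q x p.
Proof. by rewrite /phi mulr_sumr; apply: eq_bigr => w _; rewrite mevalZ -mulrA. Qed.

Lemma phi_point n (x y : 'I_n.+1 -> k) p : injective x -> injective y ->
  p \is n.-homog -> phi q x p = phi q y p.
Proof.
by move=> xi yi hp; have [//|c [_ hc]] := @alternant_constant _ _ q p _ hp; rewrite !hc.
Qed.

(** Characteristic zero makes these coordinates distinct and nonzero, so that a coordinate [0] can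
    still be appended. *)
Definition nat_point n (i : 'I_n) : k := (i.+1)%:R.

Lemma nat_point_neq0 n (i : 'I_n) : nat_point i != 0.
Proof. by rewrite /nat_point (proj1 (pcharf0P k) hchar). Qed.

Lemma nat_point_inj n : injective (@nat_point n).
Proof.
move=> i j; wlog hij : i j / (i <= j)%N => [hw|].
  by case: (leqP i j) => h e; [exact: hw|apply/esym/hw => //; exact: ltnW].
move=> e; have : ((j.+1 - i.+1)%:R : k) = 0 by rewrite natrB // -/(nat_point j) -/(nat_point i) e subrr.
move=> /eqP; rewrite (proj1 (pcharf0P k) hchar) => h.
by apply: val_inj => /=; lia.
Qed.

Lemma insert0_nat_point_inj n : injective (insert_at 0 ord_max (@nat_point n)).
Proof.
move=> i j; rewrite /insert_at; case: (unliftP ord_max i) => [a|] ->;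
  case: (unliftP ord_max j) => [b|] -> //.
- by move=> /nat_point_inj ->.
- by move=> e; have := nat_point_neq0 a; rewrite e eqxx.
- by move=> e; have := nat_point_neq0 b; rewrite -e eqxx.
Qed.

Lemma phi_rec n (x : 'I_n.+2 -> k) p (g : 'I_n.+1 -> {mpoly k[n.+1]}) :
  injective x -> p \is n.+1.-homog ->
  (forall s z, (forall i, z i != 0) -> z s * (g s).@[z] =
     p.@[insert_at 0 (lift ord0 s) z] - p.@[insert_at 0 (widen_ord (leqnSn n.+1) s) z]) ->
  phi q x p = \sum_(s < n.+1) q ^+ s * phi q (@nat_point n.+1) (g s).
Proof.
move=> xi hp hg; rewrite (phi_point xi (@insert0_nat_point_inj n.+1) hp).
exact: (phi_trim _ _ (@nat_point_neq0 _) hg).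
Qed.

(** Setting a variable to [0] in [Q] gives the same polynomial whichever variable is chosen, so
    trimming acts on the monomial alone. Each step lowers the number of variables and the degree of
    the monomial by one and keeps that of [Q]; the induction ends in the impossible case [n = 0]. *)
Theorem phi_quasisym n (x : 'I_n.+1 -> k) (m : 'X_{1..n.+1}) (Q : {mpoly k[n.+1]}) d :
  injective x -> quasisym Q -> Q \is d.+1.-homog -> (mdeg m + d.+1)%N = n ->
  phi q x ('X_[m] * Q) = 0.
Proof.
elim: n x m Q => [|n IH] x m Q xi sQ hQ hd; first by lia.
rewrite (@phi_rec n x _ (fun s => trim_coef k s m *: ('X_[trim_mon s m] * qres ord0 Q))) //.
- rewrite big1 // => s _; rewrite phiZ.
  have [->|hc] := eqVneq (trim_coef k s m) 0; first by rewrite mul0r mulr0.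
  rewrite IH ?mulr0 //; first exact: nat_point_inj.
  + exact: quasisym_qres.
  + exact: qres_homog.
  + by have := trim_mon_mdeg hc; lia.
- have := dhomogM (p := 'X_[m]) (d := mdeg m) _ hQ; rewrite hd; apply.
  by rewrite dhomogX.
move=> s z _; rewrite mevalZ !mevalM.
have eQ t : Q.@[insert_at 0 t z] = (qres ord0 Q).@[z] by rewrite -meval_qres (qres_indep t ord0 sQ).
by rewrite !eQ -mulrBl -trim_monE !mulrA.
Qed.

(** By induction the trimmed monomials are evaluated at the powers of [q], where the weight [q ^+ s]
    is exactly the factor [z s] of [trim_monE]. The recursion becomes a telescoping sum over the
    positions of the inserted [0]. *)
Theorem phi_ABB n (x : 'I_n.+1 -> k) (c : 'X_{1..n.+1}) :
  injective x -> ABB c -> mdeg c = n ->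
  phi q x 'X_[c] = ('X_[c] : {mpoly k[n.+1]}).@[fun i => q ^+ i].
Proof.
elim: n x c => [|n IH] x c xi hc hd.
  have -> : c = 0%MM by apply/eqP; rewrite -mdeg_eq0 hd.
  rewrite mpolyX0 /phi !meval1.
  rewrite (eq_bigr (fun _ => 1)) => [|w _]; last first.
    by rewrite meval1 mul1r enum_ordSl (size0nil (size_enum_ord 0)) /= /seqvdm /= !big_nil !mulr1 invr1 ?mulr1.
  by rewrite sumr_const card_Sn.
pose e (i : 'I_n.+1) := q ^+ i.
pose f (t : 'I_n.+2) := ('X_[c] : {mpoly k[n.+2]}).@[insert_at 0 t e].
rewrite (@phi_rec n x _ (fun s => trim_coef k s c *: 'X_[trim_mon s c])) //; last first.
- by move=> s z _; rewrite mevalZ trim_monE.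
- by rewrite dhomogX /= hd.
transitivity (\sum_(s < n.+1) (f (lift ord0 s) - f (widen_ord (leqnSn n.+1) s))).
  apply: eq_bigr => s _; rewrite phiZ /f -trim_monE; congr (_ * _).
  have [->|h] := eqVneq (trim_coef k s c) 0; first by rewrite !mul0r.
  rewrite IH //; first exact: nat_point_inj.
  - exact: trim_mon_ABB h hc.
  - by have := trim_mon_mdeg h; lia.
have -> : \sum_(s < n.+1) (f (lift ord0 s) - f (widen_ord (leqnSn n.+1) s)) = f ord_max - f ord0.
  have h : f ord0 + \sum_(s < n.+1) f (lift ord0 s)
      = \sum_(s < n.+1) f (widen_ord (leqnSn n.+1) s) + f ord_max.
    by transitivity (\sum_t f t); [rewrite [RHS]big_ord_recl | rewrite [LHS]big_ord_recr].
  rewrite sumrB; have -> : f ord_max = f ord0 + \sum_(s < n.+1) f (lift ord0 s)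
      - \sum_(s < n.+1) f (widen_ord (leqnSn n.+1) s) by rewrite h addrAC subrr add0r.
  by ring.
(* Otherwise the exponents from index [1] on would sum to [n + 1], against the ABB bound [n] there.
   Hence the end term [f ord0] is zero. *)
have c0 : c ord0 != 0%N.
  apply/eqP => c0; have /forallP/(_ (lift ord0 ord0)) := hc.
  rewrite -sum_mdel_ge //= => h.
  have := mdeg_mdel c0; rewrite hd mdegE => h'.
  by move: h; rewrite (eq_bigl xpredT) // h' /bump; lia.
have cmax : c ord_max = 0%N.
  have /forallP/(_ ord_max) := hc; rewrite (bigD1 ord_max) //= subnn; lia.
rewrite /f !meval_monomial_ins (negPf c0) cmax eqxx subr0 !mevalX.
rewrite [RHS](bigD1_ord ord_max) //= cmax expr0 mul1r; apply: eq_bigr => i _.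
by rewrite mnmE /e /= /bump leqNgt ltn_ord.
Qed.

End Evaluation.

(** * The bracket as a constant *)

Lemma sign_cancel (K : fieldType) (e : bool) (a b c v : K) : a != 0 -> v != 0 ->
  c / a * (b * a / ((-1) ^+ e * v)) * v = (-1) ^+ e * (c * b).
Proof. by move=> ha hv; case: e; rewrite ?expr0 ?expr1; field; rewrite ?ha ?hv ?oner_neq0 ?oppr_eq0 ?oner_neq0. Qed.

Section Fractions.
Variables (m : nat) (k : fieldType).
Local Notation n := m.+1.
Local Notation P := {mpoly k[n]}.
Local Notation F := {fraction {mpoly k[n]}}.

Lemma frac_repr (g : F) :
  g = (frac (generic_quotient.repr g)).1%:F / (frac (generic_quotient.repr g)).2%:F.
Proof.
set r := generic_quotient.repr g; have r0 := denom_ratioP r.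
have <- : g * (frac r).2%:F = (frac r).1%:F; last by rewrite mulfK // tofrac_eq0.
have -> : g = generic_quotient.pi F r by rewrite /r generic_quotient.reprK.
rewrite [LHS]generic_quotient.piE; unlock FracField.tofrac.
apply/generic_quotient.eqmodP => /=.
by rewrite FracField.equivfE /FracField.mulf !numden_Ratio ?mulr1 ?oner_neq0 // mulrC.
Qed.

Lemma fracP (g : F) : exists p d : P, d != 0 /\ g = p%:F / d%:F.
Proof.
exists (frac (generic_quotient.repr g)).1, (frac (generic_quotient.repr g)).2.
by split; [exact: denom_ratioP | exact: frac_repr].
Qed.

(** Same expression as [sfrac], for an arbitrary permutation, so that [sfracE] holds by
    conversion. *)
Definition frac_act (w : 'S_n) (g : F) : F :=
  (msym w (frac (generic_quotient.repr g)).1)%:F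
  / (msym w (frac (generic_quotient.repr g)).2)%:F.

Lemma msym_neq0 (w : 'S_n) (d : P) : d != 0 -> msym w d != 0.
Proof. by move=> hd; rewrite -(msym0 _ w) (inj_eq (@inj_msym _ _ w)). Qed.

(** Independence of the representative: equality of fractions is a polynomial identity, and [msym w]
    preserves it. *)
Lemma frac_act_div w (p d : P) : d != 0 -> frac_act w (p%:F / d%:F) = (msym w p)%:F / (msym w d)%:F.
Proof.
move=> hd; set g := _ / _; rewrite /frac_act; have := frac_repr g.
have := denom_ratioP (generic_quotient.repr g).
move: (frac _).1 (frac _).2 => p' d' hd' e.
apply/eqP; rewrite eqr_div ?tofrac_eq0 ?msym_neq0 // -!tofracM -!msymM tofrac_eq.
rewrite (inj_eq (@inj_msym _ _ w)) -tofrac_eq !tofracM -eqr_div ?tofrac_eq0 //.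
by rewrite -e.
Qed.

Lemma frac_act_tofrac w p : frac_act w p%:F = (msym w p)%:F.
Proof. by rewrite -[p%:F]divr1 -tofrac1 frac_act_div ?oner_neq0 // msym1 tofrac1 divr1. Qed.

Lemma frac_actM w g h : frac_act w (g * h) = frac_act w g * frac_act w h.
Proof.
have [p [d [hd ->]]] := fracP g; have [p' [d' [hd' ->]]] := fracP h.
rewrite mulf_div -!tofracM !frac_act_div ?mulf_neq0 // !msymM !tofracM.
by rewrite mulf_div.
Qed.

Lemma frac_actD w g h : frac_act w (g + h) = frac_act w g + frac_act w h.
Proof.
have [p [d [hd ->]]] := fracP g; have [p' [d' [hd' ->]]] := fracP h.
rewrite addf_div ?tofrac_eq0 // -!tofracM -tofracD !frac_act_div ?mulf_neq0 //.
by rewrite msymD !msymM addf_div ?tofrac_eq0 ?msym_neq0 // !tofracD !tofracM.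
Qed.

Lemma frac_actN w g : frac_act w (- g) = - frac_act w g.
Proof.
have [p [d [hd ->]]] := fracP g.
by rewrite -mulNr -tofracN !frac_act_div // msymN tofracN mulNr.
Qed.

Lemma frac_actV w g : frac_act w g^-1 = (frac_act w g)^-1.
Proof.
have [p [d [hd ->]]] := fracP g; rewrite invf_div frac_act_div // invf_div.
have [->|hp] := eqVneq p 0; last by rewrite frac_act_div.
by rewrite msym0 tofrac0 !invr0 !mulr0 -tofrac0 frac_act_tofrac msym0.
Qed.

Lemma frac_act_comp w v g : frac_act w (frac_act v g) = frac_act (v * w)%g g.
Proof.
have [p [d [hd ->]]] := fracP g.
by rewrite !frac_act_div ?msym_neq0 // !msymMm.
Qed.

Lemma frac_act1 g : frac_act 1%g g = g.
Proof. by have [p [d [hd ->]]] := fracP g; rewrite frac_act_div // !msym1m. Qed.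

Lemma sfracE j (g : F) : sfrac j g = frac_act (sperm n j) g.
Proof. by []. Qed.

Definition fX (i : 'I_n) : F := ('X_i : P)%:F.

Lemma xvE i : (i < n)%N -> xv n k i = fX (inord i).
Proof.
move=> hi; rewrite /xv insubT /fX; congr (('X_ _)%:F).
by apply: val_inj; rewrite /= inordK.
Qed.

Lemma frac_act_fX w i : frac_act w (fX i) = fX (w i).
Proof.
rewrite /fX frac_act_tofrac msym_monomial (bigD1 i) //= mnm1E eqxx expr1 big1 ?mulr1 //.
by move=> j hj; rewrite mnm1E eq_sym (negPf hj) expr0.
Qed.

Lemma msymC (w : 'S_n) (c : k) : msym w (c%:MP : P) = c%:MP.
Proof. by rewrite -[c%:MP]mulr1 mul_mpolyC msymZ msym1. Qed.

Variable q : k.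
Local Notation qF := ((q%:MP : P)%:F).
Local Notation Xs := [seq 'X_i : P | i <- enum 'I_n].

Lemma frac_act_Top w j g : (0 < j < n)%N ->
  frac_act w (Top q j g) = hecke_op qF fX j [ffun v => frac_act v g] w.
Proof.
move=> hj; have [j0 jn] := andP hj.
rewrite /Top /ddiff !sfracE sperm_sadj // !xvE; [|by []|by lia].
rewrite ffunE !(frac_actD, frac_actM, frac_actN, frac_actV, frac_act_comp) !frac_act_fX !ffunE.
by rewrite frac_act_tofrac msymC rmorphB /= rmorph1 tofracB tofrac1 sadjL.
Qed.

Lemma frac_act_Tword u g : valid_word n u ->
  [ffun w => frac_act w (Tword q u g)] = hecke_word qF fX u [ffun w => frac_act w g].
Proof.
elim: u => [|j u IH] //= /andP[hj /IH <-].
by apply/ffunP => w; rewrite ffunE frac_act_Top.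
Qed.

Lemma fX_inj : injective fX.
Proof.
move=> i j /eqP; rewrite /fX tofrac_eq => /eqP /(congr1 (mcoeff U_(i))).
rewrite !mcoeffXU eqxx; case: eqP => // _ /eqP; by rewrite oner_eq0.
Qed.

Lemma fX_qneq i j : i != j -> fX i - qF * fX j != 0.
Proof.
move=> hij; rewrite /fX -tofracM -tofracB tofrac_eq0; apply/eqP.
move=> /(congr1 (mcoeff U_(i))) /eqP.
by rewrite mcoeffB mcoeffCM !mcoeffXU eqxx [j == i]eq_sym (negPf hij) mulr0 subr0 mcoeff0 oner_eq0.
Qed.

Lemma map_msym w : map (msym w) Xs = [seq 'X_(w i) | i <- enum 'I_n].
Proof.
rewrite -map_comp; apply: eq_map => i /=.
rewrite msym_monomial (bigD1 i) //= mnm1E eqxx expr1 big1 ?mulr1 //.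
by move=> j hj; rewrite mnm1E eq_sym (negPf hj) expr0.
Qed.

Lemma map_tofrac_msym w :
  map (@FracField.tofrac P) (map (msym w) Xs) = [seq fX (w i) | i <- enum 'I_n].
Proof. by rewrite map_msym -map_comp. Qed.

Lemma map_tofrac : map (@FracField.tofrac P) Xs = [seq fX i | i <- enum 'I_n].
Proof. by rewrite -map_comp. Qed.

Lemma denominatorE :
  \prod_(0 <= i < n.-1) (qF * xv n k i - xv n k i.+1) = (seqadj q%:MP Xs)%:F.
Proof.
rewrite rmorph_seqadj map_tofrac seqadj_nth size_map size_enum_ord.
apply: eq_big_nat => i /andP[_ hi] /=.
rewrite !xvE; [|by lia|by lia].
have e l : (l < n)%N -> nth 0 [seq fX i | i <- enum 'I_n] l = fX (inord l).
  move=> hl; rewrite (nth_map ord0) ?size_enum_ord //; congr fX.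
  by apply: val_inj; rewrite /= nth_enum_ord // inordK.
by rewrite !e //; lia.
Qed.

(** In [hecke_symE] the adjacent factors cancel against the denominator of the bracket, which leaves
    [seqnum]; the sign comes from comparing the permuted Vandermonde product with [seqvdm Xs]. *)
Lemma bracket_alternant (rw : 'S_n -> seq nat) (f : P) :
  (forall w, reduced_word (rw w) w) ->
  bracket q rw f * (seqvdm Xs)%:F =
  (\sum_(w : 'S_n) (-1) ^+ w * msym w (f * seqnum q%:MP Xs))%:F.
Proof.
move=> hrw; have hg w : desc_word (rw w) w by apply: reduced_desc_word.
rewrite /bracket denominatorE; set g0 := _ / _.
pose G : {ffun 'S_n -> F} := [ffun w => frac_act w g0].
have -> : \sum_w Tword q (rw w) g0 = hecke_sym qF fX rw G 1%g.
  rewrite /hecke_sym sum_ffunE; apply: eq_bigr => w _.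
  rewrite -frac_act_Tword ?ffunE ?frac_act1 //.
  by have [] := desc_word_prod (hg w).
rewrite (hecke_symE fX_inj fX_qneq hg) mulr_suml rmorph_sum; apply: eq_bigr => w _.
set z := [seq fX (w i) | i <- enum 'I_n].
have adj0 : seqadj q%:MP Xs != 0.
  have : seqadj qF [seq fX i | i <- enum 'I_n] != 0.
    have : pairprod (fun a b => qF * a - b) [seq fX i | i <- enum 'I_n] != 0.
      rewrite pairprod_ord; apply/prodf_neq0 => -[i j] /= hij.
      rewrite -opprB oppr_eq0; apply: fX_qneq; rewrite -val_eqE /=; lia.
    by rewrite -seqnum_adj mulf_eq0 negb_or => /andP[].
  by rewrite -map_tofrac -rmorph_seqadj tofrac_eq0.
have zadjE : (msym w (seqadj q%:MP Xs))%:F = seqadj qF z.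
  by rewrite !rmorph_seqadj /= msymC map_tofrac_msym.
have zadj0 : seqadj qF z != 0 by rewrite -zadjE tofrac_eq0 msym_neq0.
have -> : \prod_(p : 'I_n * 'I_n | (p.1 < p.2)%N) hecke_factor qF fX w p =
    seqnum qF z * seqadj qF z / seqvdm z.
  rewrite seqnum_adj /seqvdm /z !pairprod_ord -prodf_div.
  by apply: eq_bigr.
have zv : seqvdm z = (-1) ^+ w * (seqvdm Xs)%:F.
  by rewrite rmorph_seqvdm map_tofrac seqvdm_perm.
have v0 : (seqvdm Xs)%:F != 0 by rewrite rmorph_seqvdm map_tofrac seqvdm_neq0 //; exact: fX_inj.
rewrite /G ffunE /g0 frac_act_div // zv rmorphM rmorph_sign msymM rmorphM /=.
rewrite zadjE; have -> : (msym w (seqnum q%:MP Xs))%:F = seqnum qF z.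
  by rewrite !rmorph_seqnum /= msymC map_tofrac_msym.
exact: sign_cancel.
Qed.

Theorem bracketE (rw : 'S_n -> seq nat) (f : P) (x : 'I_n -> k) :
  (forall w, reduced_word (rw w) w) -> f \is m.-homog -> injective x ->
  bracket q rw f = ((phi q x f)%:MP : P)%:F.
Proof.
move=> hrw hf xi; have [//|c [hc ->//]] := @alternant_constant _ _ q f _ hf.
have v0 : (seqvdm Xs)%:F != 0 by rewrite rmorph_seqvdm map_tofrac seqvdm_neq0 //; exact: fX_inj.
by apply: (mulIf v0); rewrite bracket_alternant // hc tofracM.
Qed.

End Fractions.

(** * A linear functional extending the bracket to all degrees *)

Section Functional.
Variables (m : nat) (k : fieldType) (q : k).
Hypothesis hchar : [pchar k] =i pred0.
Local Notation n := m.+1.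
Local Notation P := {mpoly k[n]}.
Local Notation x0 := (@nat_point k n).
Local Notation pad e := (U_(ord0) *+ e)%MM.

(* Padding a monomial with a power of x_1 up to degree [m = n - 1] preserves the ABB condition
   and the value at [(1, q, .., q^(n-1))]; this takes care of the lower-degree components of
   [g] and [h]. *)
Definition lfunc (p : P) : k :=
  \sum_(e : 'X_{1..n < n}) p@_e * phi q x0 'X_[pad (m - mdeg e) + e].

Lemma phi_sum (I : Type) (r : seq I) (Pr : pred I) (G : I -> P) x :
  phi q x (\sum_(i <- r | Pr i) G i) = \sum_(i <- r | Pr i) phi q x (G i).
Proof.
apply: (big_morph (phi q x)); first exact: phiD.
by rewrite -(scale0r 0) phiZ mul0r.
Qed.

Lemma lfuncD p r : lfunc (p + r) = lfunc p + lfunc r.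
Proof. by rewrite /lfunc -big_split; apply: eq_bigr => e _; rewrite mcoeffD mulrDl. Qed.

Lemma lfuncZ c p : lfunc (c *: p) = c * lfunc p.
Proof. by rewrite /lfunc mulr_sumr; apply: eq_bigr => e _; rewrite mcoeffZ mulrA. Qed.

Lemma lfunc_sum (I : Type) (r : seq I) (Pr : pred I) (G : I -> P) :
  lfunc (\sum_(i <- r | Pr i) G i) = \sum_(i <- r | Pr i) lfunc (G i).
Proof.
apply: (big_morph lfunc); first exact: lfuncD.
by rewrite -(scale0r 0) lfuncZ mul0r.
Qed.

Lemma msize_leq (p : P) : (forall e, e \in msupp p -> (mdeg e <= m)%N) -> (msize p <= n)%N.
Proof. by move=> h; rewrite msizeE; apply/bigmax_leqP_seq => e he _; apply: h. Qed.

(** All monomials of a homogeneous polynomial receive the same padding, which therefore factors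
    out. *)
Lemma lfunc_homog d (p : P) : p \is d.-homog -> (d <= m)%N ->
  lfunc p = phi q x0 ('X_[pad (m - d)] * p).
Proof.
move=> /dhomogP hp hd; have hs : (msize p <= n)%N.
  by apply: msize_leq => e /hp ->.
rewrite {2}(mpolywE hs) mulr_sumr phi_sum; apply: eq_bigr => e _.
rewrite -scalerAr phiZ -mpolyXD.
have [->|he] := eqVneq p@_e 0; first by rewrite !mul0r.
by rewrite (hp e) ?mcoeff_msupp.
Qed.

Lemma lfunc_homog_gt d (p : P) : p \is d.-homog -> (m < d)%N -> lfunc p = 0.
Proof.
move=> hp hd; rewrite /lfunc big1 // => e _; rewrite (dhomog_nemf_coeff hp) ?mul0r //.
by have := bmdeg e; rewrite /=; lia.
Qed.

Lemma ABB_mdeg (e : 'X_{1..n}) : ABB e -> (mdeg e <= m)%N.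
Proof. by move=> /forallP/(_ ord0) /=; rewrite subn0 (eq_bigl xpredT) // mdegE. Qed.

Lemma lfunc_in_L (g : P) : in_L g -> lfunc g = g.@[fun i => q ^+ i].
Proof.
move=> hg; have hs : (msize g <= n)%N.
  by apply: msize_leq => e /hg /ABB_mdeg.
rewrite [in RHS](mpolywE hs) raddf_sum /=; apply: eq_bigr => e _; rewrite mevalZ.
have [->|he] := eqVneq g@_e 0; first by rewrite !mul0r.
have ae : ABB e by apply: hg; rewrite mcoeff_msupp.
have de := ABB_mdeg ae.
rewrite phi_ABB //.
- by rewrite mpolyXD mevalM -mpolyXn rmorphXn /= mevalXU expr0 expr1n mul1r.
- exact: nat_point_inj.
(* At the first index the tail sum is the total degree [m], the largest value allowed; the other
   tail sums do not involve the exponent of [x_1]. *)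
- apply/forallP => i; have [i0|i0] := eqVneq i ord0.
    rewrite i0 subn0 (eq_bigl xpredT) // -mdegE mdegD mdegMn mdeg1; lia.
  rewrite (eq_bigr (fun j => e j)) => [|j hj]; first exact: (forallP ae).
  rewrite mnmDE mulmnE mnm1E; case: eqP => [j0|]; last by rewrite mul0n.
  by move: hj i0; rewrite -j0 /= leqn0 -val_eqE /= => ->.
- rewrite mdegD mdegMn mdeg1; lia.
Qed.

Lemma mcoeff_pihomog d (Q : P) e : (pihomog mdeg d Q)@_e = if mdeg e == d then Q@_e else 0.
Proof.
rewrite pihomogE raddf_sum /= [in RHS](mpolyE Q) raddf_sum /= big_mkcond.
case: ifP => he; [apply: eq_bigr|apply: big1] => e' _;
  rewrite !mcoeffZ !mcoeffX; case: ifP => he' //; case: eqP => // ee;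
  by rewrite ?mulr0 // -ee in he *; rewrite he in he'.
Qed.

(** Since the degree depends on [flat] alone, the homogeneous components of a quasisymmetric
    polynomial are quasisymmetric. *)
Lemma mdeg_flat (e : 'X_{1..n}) : mdeg e = sumn (flat e).
Proof.
rewrite mdegE /flat sumnE big_filter big_map [RHS]big_mkcond big_enum /=.
by apply: eq_bigr => i _; case: eqP.
Qed.

(** Linearity reduces to a monomial times a homogeneous component of [Q]. The component of degree
    zero vanishes, products of degree above [m] are not seen by [lfunc], and otherwise the padding
    joins the monomial and [phi_quasisym] applies. *)
Lemma lfunc_quasisym (a Q : P) : quasisym Q -> Q@_0%MM = 0 -> lfunc (a * Q) = 0.
Proof.
move=> sQ Q0; rewrite (mpolyE a) mulr_suml lfunc_sum big1 // => e _.
rewrite -scalerAl lfuncZ; apply/eqP; rewrite mulf_eq0; apply/orP; right; apply/eqP.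
rewrite {1}(@pihomog_partitionE _ _ mdeg _ Q (leqnn _)) mulr_sumr lfunc_sum big1 // => -[d hd] _ /=.
have hQ : 'X_[e] * pihomog mdeg d Q \is (mdeg e + d).-homog.
  by apply: dhomogM; [rewrite dhomogX | exact: pihomogP].
case: d {hd} hQ => [|d] hQ.
  suff -> : pihomog mdeg 0 Q = 0 by rewrite mulr0 -(scale0r 0) lfuncZ mul0r.
  apply/mpolyP => e'; rewrite mcoeff_pihomog mcoeff0 mdeg_eq0.
  by case: eqP => // ->.
case: (leqP (mdeg e + d.+1) m) => hd; last exact: lfunc_homog_gt hQ hd.
rewrite (lfunc_homog hQ hd) mulrA -mpolyXD (@phi_quasisym _ _ hchar _ _ _ _ d) //.
- exact: nat_point_inj.
- move=> e1 e2 ef; rewrite !mcoeff_pihomog !mdeg_flat ef.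
  by case: ifP => // _; apply: sQ.
- exact: pihomogP.
- rewrite mdegD mdegMn mdeg1; lia.
Qed.

Lemma lfunc_QSymPlus (h : P) : in_QSymPlus h -> lfunc h = 0.
Proof.
case=> s [hs ->]; rewrite lfunc_sum big_seq big1 // => x /hs[sx x0'].
exact: lfunc_quasisym.
Qed.

End Functional.

Theorem mainTheorem15 (k : fieldType) (q : k) (n : nat)
  (rw : 'S_n -> seq nat)
  (hchar : [pchar k] =i pred0)
  (hq : forall m : nat, (0 < m)%N -> q ^+ m = 1 -> q = 1)
  (hn : (1 <= n)%N)
  (hrw : forall w : 'S_n, reduced_word (rw w) w) :
  (forall f g h : {mpoly k[n]},
      homog_of_deg n.-1 f -> in_L g -> in_QSymPlus h -> f = g + h ->
      bracket q rw f = ((g.@[fun i : 'I_n => q ^+ i])%:MP : {mpoly k[n]})%:F)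
  /\
  (forall c : 'X_{1..n}, ABB c -> mdeg c = n.-1 ->
      bracket q rw 'X_[c]
      = ((q ^+ (\sum_(i < n) i * c i))%:MP : {mpoly k[n]})%:F).
Proof.
case: n rw hn hrw => [//|m] rw _ hrw /=.
have xi := @nat_point_inj k hchar m.+1.
split=> [f g h hf hg hh efgh|c hc hd].
  have ff : f \is m.-homog by apply/dhomogP => e /hf.
  rewrite (bracketE q hrw ff xi); congr ((_%:MP) %:F).
  (* In degree [m] the padding is trivial, so [lfunc] agrees with [phi] on [f]; linearity then
     treats [g] and [h] separately, although they may be inhomogeneous. *)
  have := lfunc_homog q ff (leqnn m); rewrite subnn mulm0n mpolyX0 mul1r => <-.
  by rewrite efgh lfuncD (lfunc_in_L q hchar hg) (lfunc_QSymPlus q hchar hh) addr0.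
have hX : ('X_[c] : {mpoly k[m.+1]}) \is m.-homog by rewrite dhomogX /= hd.
rewrite (bracketE q hrw hX xi) (phi_ABB q hchar xi hc hd); congr ((_%:MP) %:F).
by rewrite mevalX -prodrXr; apply: eq_bigr => i _; rewrite exprM.
Qed.
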